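(* Let $g$ be a measurable function on $\mathbb R^3$. Then $g\in\mathcal K^*$ if and only if there exists a positive measure $\mu$ on $\mathbb R^3$, with $\|\mu\|_{\mathcal M}=\mu(\mathbb R^3)=4\pi\|g\|_{\mathcal K^*}<\infty$, such that $$|g|\le(-\Delta)^{-1}\mu\quad\text{almost everywhere.}$$
   Context: The Kato class $\mathcal K$ on $\mathbb R^3$ is the space of functions $f$ with $\|f\|_{\mathcal K}=\sup_{y\in\mathbb R^3}\int_{\mathbb R^3}\frac{|f(x)|\,dx}{|x-y|}<\infty$. $\mathcal K^*$ is its dual regarded as a space of functions: $\|g\|_{\mathcal K^*}=\sup\{\int_{\mathbb R^3}|f(x)g(x)|\,dx:\ \|f\|_{\mathcal K}\le1\}$, and $g\in\mathcal K^*$ means that this is finite. $\mathcal M$ is the space of measures of bounded variation. $(-\Delta)^{-1}\mu(x)=\frac1{4\pi}\int_{\mathbb R^3}\frac{d\mu(y)}{|x-y|}$. *)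

(* Defs.v *)
From HB Require Import structures.
From mathcomp Require Import all_boot all_order all_algebra.
From mathcomp Require Import all_classical all_reals all_analysis.
From mathcomp Require Import measurable_realfun.

Set Implicit Arguments.
Unset Strict Implicit.
Unset Printing Implicit Defensive.

Import Order.TTheory GRing.Theory Num.Theory.

Local Open Scope classical_set_scope.
Local Open Scope ring_scope.
Local Open Scope ereal_scope.

Notation R3 R := (measurableTypeR R * measurableTypeR R * measurableTypeR R)%type.

(* The canonical norm of a product type is the sup norm, hence this explicit
   Euclidean distance. *)
Definition dist3 (R : realType) (x y : R3 R) : R :=
  Num.sqrt ((x.1.1 - y.1.1) ^+ 2 + (x.1.2 - y.1.2) ^+ 2 +
            (x.2 - y.2) ^+ 2)%R.

(* Inverse in the extended reals: the kernel is +oo on the diagonal. *)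
Definition riesz_kernel (R : realType) (x y : R3 R) : \bar R :=
  (dist3 x y)%:E^-1.

Definition leb3 (R : realType) : {measure set (R3 R) -> \bar R} :=
  (@lebesgue_measure R \x @lebesgue_measure R) \x @lebesgue_measure R.

(* [leb3] lives on the Borel sets; Lebesgue measurability refers to its
   completion.  For a nonnegative [f] measurable in this sense,
   [\int[leb3 R]_x f x], the supremum of the integrals of the Borel simple
   functions below [f], is the Lebesgue integral of [f]. *)
Definition lebesgue_measurable_fun (R : realType) (f : R3 R -> R) : Prop :=
  forall B : set (measurableTypeR R), measurable B ->
    (completed_algebra_gen (leb3 R)).-sigma.-measurable (f @^-1` B).

Definition kato_norm (R : realType) (f : R3 R -> R) : \bar R :=
  ereal_sup [set \int[leb3 R]_x (`|f x|%:E * riesz_kernel x y)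
            | y in [set: R3 R]].

Definition kato (R : realType) : set (R3 R -> R) :=
  [set f | lebesgue_measurable_fun f /\ kato_norm f < +oo].

Definition kato_dual_norm (R : realType) (g : R3 R -> R) : \bar R :=
  ereal_sup [set \int[leb3 R]_x `|f x * g x|%:E
            | f in [set f | @kato R f /\ kato_norm f <= 1]].

Definition kato_dual (R : realType) : set (R3 R -> R) :=
  [set g | lebesgue_measurable_fun g /\ kato_dual_norm g < +oo].

Definition variation_norm (R : realType) d (T : measurableType d)
    (mu : set T -> \bar R) : \bar R :=
  ereal_sup [set s | exists n (F : nat -> set T),
    [/\ forall i, measurable (F i), trivIset [set: nat] F &
        s = \sum_(i < n) `|mu (F i)| ]].

Definition inv_laplacian (R : realType) (mu : set (R3 R) -> \bar R)
    (x : R3 R) : \bar R :=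
  ((4 * pi)^-1)%R%:E * \int[mu]_y riesz_kernel x y.

(* Main.v *)
Require Import Defs.
From HB Require Import structures.
From mathcomp Require Import all_boot all_order all_algebra.
From mathcomp Require Import all_classical all_reals all_analysis.
From mathcomp Require Import measurable_realfun lra ring.

(* The representation is the dual of the linear program defining the norm of the
   dual Kato class.  Let N be that norm and, for a bounded compactly supported
   f >= 0, let Uf(y) be the integral of f(x) / |x - y| dx.  By definition of N,
   the integral of f |g| is at most N sup Uf.  Hence
     p(h) = inf { N s - (integral of f |g|) : h + Uf <= s }
   is a finite sublinear functional on bounded functions, and any linear
   functional Lam <= p is positive, has Lam(1) <= N, and satisfies
   Lam(Uf) >= (integral of f |g|).  Since Uf is continuous and vanishes at
   infinity, Lam(Uf) is at most the integral of Uf against a measure nu of mass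
   N.  By Tonelli, the integral of f |g| is at most that of f U(nu) for all f,
   so |g| <= U(nu) almost everywhere, and mu = 4 pi nu. *)

(** [Lam] comes from Zorn's lemma and is only finitely additive on indicators, so no measure can
    simply be read off it. Instead an interval of length Lam(1) is split again and again in
    proportion to the masses of the cells cut out by rational half-spaces; points chosen in the
    cells containing t have a limit Z t, and nu is the image of Lebesgue measure under Z. Mass that
    [Lam] carries at infinity appears as parameters t whose points leave every cube; it contributes
    nothing because Uf vanishes there. Since only an upper bound of Lam(Uf) is wanted and Uf >= 0,
    the interval may be lengthened to [0, N), which makes the mass exactly N.

    A second obstacle is that g is only Lebesgue measurable whereas Tonelli is applied to Borel
    functions: |g| is replaced by a Borel function g' that is below it everywhere and equal to it
    almost everywhere. *)

Import Order.TTheory GRing.Theory Num.Theory numFieldNormedType.Exports.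

Set Implicit Arguments.
Unset Strict Implicit.
Unset Printing Implicit Defensive.

Local Open Scope classical_set_scope.
Local Open Scope ring_scope.

(** * Linear functionals below a sublinear functional *)

Section hahn_banach.
Context {R : realType} {V : lmodType R} (B : set V).
Hypotheses (BD : forall x y, B x -> B y -> B (x + y))
           (BZ : forall (a : R) x, B x -> B (a *: x)).

(** The subspace is a predicate [B] rather than a type: [V] will be the space of all functions and
    [B] the bounded ones, where the infimum defining p is finite. *)
Definition sublinear_on (p : V -> R) :=
  (forall x y, B x -> B y -> p (x + y) <= p x + p y) /\
  (forall (a : R) x, 0 <= a -> B x -> p (a *: x) = a * p x).

Let BN x : B x -> B (- x). Proof. by move=> /(BZ (-1)); rewrite scaleN1r. Qed.

Lemma sublinear_on0 p x : sublinear_on p -> B x -> p 0 = 0.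
Proof. by move=> [_ pZ] Bx; rewrite -(scale0r x) pZ ?mul0r. Qed.

Lemma sublinear_onN p x : sublinear_on p -> B x -> - p (- x) <= p x.
Proof.
move=> sp Bx; have [pD pZ] := sp.
have := pD _ _ Bx (BN Bx); rewrite subrr (sublinear_on0 sp Bx); lra.
Qed.

(* [sublinear_tilt q v] is sublinear, lies below [q], and is at most [- q v] at
   [- v]: a minimal [q] is therefore odd, hence linear. *)
Definition sublinear_tilt (q : V -> R) (v x : V) :=
  inf [set q (x + t *: v) - t * q v | t in [set t : R | 0 <= t]].

Lemma sublinear_tilt_lb q v x : sublinear_on q -> B v -> B x ->
  lbound [set q (x + t *: v) - t * q v | t in [set t : R | 0 <= t]] (- q (- x)).
Proof.
move=> [qD qZ] Bv Bx _ [t /= t0 <-].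
have := qD _ _ (BD Bx (BZ t Bv)) (BN Bx).
by rewrite addrAC subrr add0r qZ//; lra.
Qed.

Lemma sublinear_tilt_le q v x t : sublinear_on q -> B v -> B x -> 0 <= t ->
  sublinear_tilt q v x <= q (x + t *: v) - t * q v.
Proof.
move=> sq Bv Bx t0; apply: ge_inf; last by exists t.
by exists (- q (- x)); exact: sublinear_tilt_lb.
Qed.

Lemma le_sublinear_tilt q v x c :
  (forall t : R, 0 <= t -> c <= q (x + t *: v) - t * q v) ->
  c <= sublinear_tilt q v x.
Proof.
move=> cq; apply: lb_le_inf => [|_ [t /= t0 <-]]; last exact: cq.
by exists (q (x + 0 *: v) - 0 * q v); exists 0 => /=.
Qed.

(** Parameters s and t chosen for x and y combine into s + t for x + y, and t for x becomes a t for
    a x. Applying the resulting inequality to a and to its inverse gives homogeneity. *)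
Lemma sublinear_on_tilt q v : sublinear_on q -> B v ->
  sublinear_on (sublinear_tilt q v).
Proof.
move=> sq Bv; have [qD qZ] := sq.
have tD x y : B x -> B y ->
    sublinear_tilt q v (x + y) <= sublinear_tilt q v x + sublinear_tilt q v y.
  move=> Bx By; rewrite -lerBlDr; apply: le_sublinear_tilt => s s0.
  rewrite lerBlDr -lerBlDl; apply: le_sublinear_tilt => t t0.
  have := sublinear_tilt_le sq Bv (BD Bx By) (addr_ge0 s0 t0).
  have := qD _ _ (BD Bx (BZ s Bv)) (BD By (BZ t Bv)).
  rewrite addrACA -scalerDl. by move=> h1 h2; lra.
have tZ (a : R) x : 0 < a -> B x ->
    sublinear_tilt q v (a *: x) <= a * sublinear_tilt q v x.
  move=> a0 Bx; rewrite -ler_pdivrMl//; apply: le_sublinear_tilt => t t0.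
  rewrite ler_pdivrMl//.
  have := sublinear_tilt_le sq Bv (BZ a Bx) (mulr_ge0 (ltW a0) t0).
  rewrite -scalerA -scalerDr qZ ?(ltW a0)//; last exact: BD (BZ _ _).
  lra.
split=> // a x; rewrite le_eqVlt => /predU1P[<- Bx|a0 Bx]; last first.
  apply/eqP; rewrite eq_le tZ//= -ler_pdivlMl//.
  have := tZ a^-1 (a *: x); rewrite scalerK ?gt_eqF//.
  by apply; [rewrite invr_gt0|exact: BZ].
rewrite scale0r mul0r; apply/eqP; rewrite eq_le; apply/andP; split.
  have B0 : B 0 by rewrite -(scale0r x); exact: BZ.
  have := sublinear_tilt_le sq Bv B0 (lexx 0).
  by rewrite scale0r addr0 (sublinear_on0 sq Bx) mul0r subr0.
by apply: le_sublinear_tilt => t t0; rewrite add0r qZ// subrr.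
Qed.

(** Instead of extending a functional one dimension at a time, Zorn's lemma yields a minimal
    sublinear functional below p. The order compares values on [B] only, hence is a mere preorder. A
    chain is bounded below by its pointwise infimum, finite because every member is at least - p (-
    x). *)
Theorem hahn_banach (p : V -> R) : sublinear_on p ->
  exists l : V -> R, [/\ forall x, B x -> l x <= p x,
    forall x y, B x -> B y -> l (x + y) = l x + l y &
    forall (a : R) x, B x -> l (a *: x) = a * l x].
Proof.
move=> sp.
pose S := {q : V -> R | sublinear_on q /\ forall x, B x -> q x <= p x}.
pose p0 : S := exist _ p (conj sp (fun x _ => lexx (p x))).
pose r (q1 q2 : S) := `[< forall x, B x -> sval q2 x <= sval q1 x >].
have [q] : exists t, premaximal r t.
  apply: (ZL_preorder p0) => [q|q1 q2 q3 /asboolP h1 /asboolP h2|C Ctot].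
  - exact/asboolP.
  - by apply/asboolP => x Bx; exact: (le_trans (h2 _ Bx) (h1 _ Bx)).
  have [[c0 Cc0]|C0] := pselect (C !=set0); last first.
    by exists p0 => s Cs; exfalso; apply: C0; exists s.
  pose E x := [set sval q x | q in C].
  pose m x := inf (E x).
  have m_le q x : C q -> B x -> m x <= sval q x.
    move=> Cq Bx; apply: ge_inf; last by exists q.
    exists (- p (- x)) => _ [q' Cq' <-]; case: q' {Cq'} => q' [sq' q'p] /=.
    by apply: le_trans (sublinear_onN sq' Bx); rewrite lerN2; exact/q'p/BN.
  have le_m x c : (forall q, C q -> c <= sval q x) -> c <= m x.
    move=> h; apply: lb_le_inf; first by exists (sval c0 x); exists c0.
    by move=> _ [q Cq <-]; exact: h.
  have sm : sublinear_on m.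
    split=> [x y Bx By|a x].
      rewrite -lerBlDr; apply: (@le_m) => q1 Cq1.
      rewrite lerBlDr -lerBlDl; apply: (@le_m) => q2 Cq2; rewrite lerBlDl.
      (* Subadditivity is available only for a single functional, so the smaller of the two members
         of the chain is used at both x and y. *)
      have [/asboolP h|/asboolP h] := Ctot _ _ Cq1 Cq2.
        apply: le_trans (m_le _ _ Cq2 (BD Bx By)) _.
        apply: le_trans ((svalP q2).1.1 _ _ Bx By) _.
        by rewrite lerD2r h.
      apply: le_trans (m_le _ _ Cq1 (BD Bx By)) _.
      apply: le_trans ((svalP q1).1.1 _ _ Bx By) _.
      by rewrite lerD2l h.
    rewrite le_eqVlt => /predU1P[<- Bx|a0 Bx].
      rewrite mul0r; apply/eqP; rewrite eq_le; apply/andP; split.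
        apply: le_trans (m_le _ _ Cc0 (BZ _ Bx)) _.
        by rewrite (svalP c0).1.2// mul0r.
      by apply: (@le_m) => q Cq; rewrite (svalP q).1.2// mul0r.
    apply/eqP; rewrite eq_le; apply/andP; split.
      rewrite -ler_pdivrMl//; apply: (@le_m) => q Cq; rewrite ler_pdivrMl//.
      by rewrite -(svalP q).1.2 ?(ltW a0)//; exact/m_le/BZ.
    apply: (@le_m) => q Cq; rewrite (svalP q).1.2 ?(ltW a0)//.
    by rewrite ler_pM2l//; exact: m_le.
  have mp x : B x -> m x <= p x.
    by move=> Bx; apply: le_trans (m_le _ _ Cc0 Bx) _; exact: (svalP c0).2.
  exists (exist _ m (conj sm mp)) => s Cs; apply/asboolP => x Bx /=.
  exact: m_le.
case: q => q [sq qp] qmin; have [qD qZ] := sq.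
have qN v : B v -> q (- v) = - q v.
  move=> Bv; have tq x : B x -> sublinear_tilt q v x <= q x.
    move=> Bx; have := sublinear_tilt_le sq Bv Bx (lexx 0).
    by rewrite scale0r addr0 mul0r subr0.
  have tp x : B x -> sublinear_tilt q v x <= p x.
    by move=> Bx; apply: le_trans (tq _ Bx) (qp _ Bx).
  have /asboolP := qmin (exist _ _ (conj (sublinear_on_tilt sq Bv) tp))
    (asboolT tq).
  move=> /(_ _ (BN Bv)) /=.
  (* The parameter t = 1 sends - v to 0, so the tilt is at most - q v there; by minimality so is q
     (- v). *)
  have := sublinear_tilt_le sq Bv (BN Bv) ler01.
  rewrite scale1r addNr (sublinear_on0 sq Bv) mul1r sub0r => h1 h2.
  apply/eqP; rewrite eq_le (le_trans h2 h1)/=.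
  by rewrite lerNl; exact: sublinear_onN.
exists q; split=> // [x y Bx By|a x Bx].
  apply/eqP; rewrite eq_le qD//= -[leRHS]opprK -qN; last exact: BD.
  by rewrite lerNr !opprD -!qN// qD//; exact: BN.
have [a0|/ltW a0] := leP 0 a; first exact: qZ.
by rewrite -[a]opprK scaleNr qN ?qZ ?oppr_ge0 ?mulNr//; exact: BZ.
Qed.

End hahn_banach.

(** * Positive functionals on functions vanishing at infinity *)

(* Every index [i >= 2] denotes the last coordinate, so that quantifying over
   [nat] quantifies over the three coordinates. *)
Definition coord3 (R : realType) (i : nat) (x : R3 R) : R :=
  match i with 0 => x.1.1 | 1 => x.1.2 | _ => x.2 end.

Lemma measurable_coord3 (R : realType) i :
  measurable_fun [set: R3 R] (@coord3 R i).
Proof.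
case: i => [|[|i]] /=; last exact: measurable_snd.
- exact: (measurableT_comp measurable_fst measurable_fst).
- exact: (measurableT_comp measurable_snd measurable_fst).
Qed.

(** The thresholds run from - K to K in steps of 1 / K. Points on the same side of all of them share
    a cell of width 1 / K, or are both below - K, or are both at least K. *)
Lemma grid_close (R : realType) (K : nat) (u v : R) : (0 < K)%N ->
  (forall a, (a <= 2 * K ^ 2)%N ->
    (u < (a%:R - K%:R ^+ 2) / K%:R) = (v < (a%:R - K%:R ^+ 2) / K%:R)) ->
  `|u - v| <= K%:R^-1 \/ (K%:R <= `|u| /\ K%:R <= `|v|).
Proof.
move=> K0 uv; have K0' : (0 : R) < K%:R by rewrite ltr0n.
have KV : K%:R * K%:R^-1 = 1 :> R by rewrite divff// gt_eqF.
have [uK|Ku] := ltP u (- K%:R).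
  right; have := uv 0%N isT; rewrite mulr0n sub0r expr2 -mulNr -mulrA KV mulr1.
  rewrite uK => /esym vK; split; rewrite ler0_norm; lra.
have [uK|{}uK] := leP K%:R u.
  right; have := uv _ (leqnn _).
  rewrite natrM natrX (_ : 2%:R * K%:R ^+ 2 - _ = K%:R * K%:R); last by ring.
  rewrite -mulrA KV mulr1 ltNge uK/= => /esym/negbT; rewrite -leNgt => vK.
  by split; rewrite ger0_norm; lra.
(* [w] is the position of u above - K in units of the grid step, and [b] is the index of its
   cell. *)
left; pose w := (u + K%:R) * K%:R; pose b := Num.truncn w.
have w0 : 0 <= w by rewrite mulr_ge0//; lra.
have /andP[bw wb] : b%:R <= w < b.+1%:R by exact: truncn_itv.
have wK : w < (2 * K ^ 2)%:R.
  by rewrite natrM natrX expr2 mulrA ltr_pM2r//; lra.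
have bK : (b < 2 * K ^ 2)%N by rewrite -(ltr_nat R); exact: le_lt_trans wK.
have := uv _ (ltnW bK); have := uv _ bK.
rewrite !ltr_pdivlMr// !ltrBrDl.
have -> : K%:R ^+ 2 + u * K%:R = w by rewrite /w; ring.
rewrite wb [w < b%:R]ltNge bw/= => /esym vb /esym/negbT; rewrite -leNgt => bv.
rewrite -[leRHS]mul1r ler_pdivlMr// -[X in _ * X]gtr0_norm// -normrM.
move: bw wb; rewrite /w ler_norml => bw wb.
by move: vb wb; rewrite -natr1 => vb wb; apply/andP; split; lra.
Qed.

(* Enumerates the half-spaces [coord3 i x < q] with [q] rational; they separate
   points up to any precision inside any cube. *)
Definition bit (R : realType) (n : nat) (x : R3 R) : bool :=
  if @unpickle (nat * rat)%type n is Some (i, q) then coord3 i x < ratr q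
  else false.

Lemma bits_grid (R : realType) (k : nat) : exists n, forall x y : R3 R,
  (forall j, (j < n)%N -> bit j x = bit j y) ->
  forall i, `|coord3 i x - coord3 i y| <= k.+1%:R^-1 \/
    (k.+1%:R <= `|coord3 i x| /\ k.+1%:R <= `|coord3 i y|).
Proof.
pose K := k.+1.
pose q (a : nat) : rat := (a%:R - K%:R ^+ 2) / K%:R.
(* Only finitely many half-spaces are consulted; the successor makes the strict bound j < n include
   the largest code. *)
pose c (p : 'I_3 * 'I_(2 * K ^ 2).+1) := (pickle (val p.1, q p.2)).+1.
exists (\max_p c p) => x y xy i.
apply: grid_close => // a aK.
pose i' := minn i 2.
have i'3 : (i' < 3)%N by rewrite ltnS geq_minr.
have E z : coord3 i z = coord3 i' z :> R.
  by rewrite /i'; case: (i) => [|[|[|j]]].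
rewrite !E.
have := xy (pickle (i', q a)); rewrite /bit pickleK /q.
rewrite fmorph_div rmorphB/= rmorphXn/= !ratr_nat; apply.
exact: (@leq_bigmax _ c (Ordinal i'3, Ordinal (aK : (a < _.+1)%N))).
Qed.

(** Uniform continuity together with vanishing at infinity. One k serves as inverse modulus and as
    radius, matching the two alternatives of [bits_grid]. *)
Definition uniform_C0 (R : realType) (h : R3 R -> R) :=
  forall e : R, 0 < e -> exists k : nat,
    (forall x y, (forall i, `|coord3 i x - coord3 i y| <= k.+1%:R^-1) ->
       `|h x - h y| <= e) /\
    (forall x i, k.+1%:R <= `|coord3 i x| -> `|h x| <= e).

Lemma uniform_C0_bits (R : realType) (h : R3 R -> R) (e : R) :
  uniform_C0 h -> 0 < e -> exists n, forall x y : R3 R,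
    (forall j, (j < n)%N -> bit j x = bit j y) -> `|h x - h y| <= e.
Proof.
move=> hC e0; have e20 : 0 < e / 2 by rewrite divr_gt0.
have [k [h1 h2]] := hC _ e20; have [n nP] := bits_grid R k.
exists n => x y /nP xy.
have [|] := pselect (forall i, `|coord3 i x - coord3 i y| <= k.+1%:R^-1).
  by move=> /h1 /le_trans; apply; lra.
move=> /existsNP[i]; case: (xy i) => // -[/h2 hx /h2 hy] _.
by apply: le_trans (ler_normB _ _) _; lra.
Qed.

Definition bounded_on_space (R : realType) (T : Type) : set (T -> R^o) :=
  [set h | exists M : R, forall x, `|h x| <= M].

Section riesz.
Context {R : realType} (Lam : (R3 R -> R) -> R) (N : R).
Notation bounded := (@bounded_on_space R (R3 R)).
Hypotheses
  (LamD : forall f g, bounded f -> bounded g ->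
    Lam (fun x => f x + g x) = Lam f + Lam g)
  (LamZ : forall (a : R) f, bounded f -> Lam (fun x => a * f x) = a * Lam f)
  (Lam_le : forall f g, bounded f -> bounded g -> (forall x, f x <= g x) ->
    Lam f <= Lam g)
  (Lam1 : Lam (fun=> 1) <= N).

Let m (A : set (R3 R)) : R := Lam \1_A.

Let bounded_indic A : bounded \1_A.
Proof.
by exists 1 => x; rewrite indicE; case: (_ \in _); rewrite ?normr1 ?normr0.
Qed.

Let bounded_cst c : bounded (fun=> c). Proof. by exists `|c|. Qed.

Let boundedM f g : bounded f -> bounded g -> bounded (fun x => f x * g x).
Proof.
move=> [M fM] [M' gM]; exists (M * M') => x.
by rewrite normrM ler_pM.
Qed.

Let m0 : m set0 = 0.
Proof.
have := LamZ 0 (bounded_indic set0); rewrite mul0r => <-.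
by congr Lam; apply/funext => x; rewrite indic0 mulr0.
Qed.

Let m_ge0 A : 0 <= m A.
Proof.
rewrite -m0; apply: Lam_le => // x.
by rewrite !indicE in_set0; case: (_ \in _).
Qed.

Let bitT k (A : set (R3 R)) := [set x | A x /\ bit k x].
Let bitF k (A : set (R3 R)) := [set x | A x /\ ~~ bit k x].

Let indic_bit k A x : \1_A x = \1_(bitT k A) x + \1_(bitF k A) x :> R.
Proof.
rewrite !indicE; have [xA|xA] := boolP (x \in A).
  have xA' := set_mem xA.
  have -> : (x \in bitT k A) = bit k x.
    by apply/idP/idP => [/set_mem[]//|xk]; exact/mem_set.
  have -> : (x \in bitF k A) = ~~ bit k x.
    by apply/idP/idP => [/set_mem[]//|xk]; exact/mem_set.
  by case: bit; rewrite ?addr0 ?add0r.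
rewrite !memNset ?addr0// => -[Ax _]; move/negP: xA; apply; exact/mem_set.
Qed.

Let Lam_split h k A : bounded h -> Lam (fun x => h x * \1_A x) =
  Lam (fun x => h x * \1_(bitT k A) x) + Lam (fun x => h x * \1_(bitF k A) x).
Proof.
move=> bh; rewrite -LamD; try exact: boundedM.
by congr Lam; apply/funext => x; rewrite (indic_bit k) mulrDr.
Qed.

Let m_split k A : m A = m (bitT k A) + m (bitF k A).
Proof.
rewrite /m -LamD//; congr Lam; apply/funext => x; exact: indic_bit.
Qed.

(* Splits [l, l + m A) in proportion to the masses of the two halves of A:
   the cells followed by t have positive mass, hence are nonempty. *)
Fixpoint cell n k (A : set (R3 R)) (l t : R) : set (R3 R) :=
  if n is n'.+1 then
    if t < l + m (bitT k A) then cell n' k.+1 (bitT k A) l t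
    else cell n' k.+1 (bitF k A) (l + m (bitT k A)) t
  else A.

(** The default point is met only for empty cells, which no t in [0, m setT) reaches when the
    splitting starts from the whole space. *)
Let repr (A : set (R3 R)) : R3 R := xget (0, 0, 0) A.

(** As t varies, the cell of depth n takes finitely many values, selected by comparing t with
    constants; hence [phi] may be arbitrary. *)
Let measurable_cell (phi : set (R3 R) -> R) n k A l :
  measurable_fun [set: measurableTypeR R] (fun t => phi (cell n k A l t)).
Proof.
elim: n k A l => [|n IHn] k A l /=; first exact: measurable_cst.
under eq_fun do rewrite (fun_if phi).
by apply: measurable_fun_ifT => //; apply: measurable_fun_ltr.
Qed.

Let cell_sub n k A l t : cell n k A l t `<=` A.
Proof.
elim: n k A l => [|n IHn] k A l //=.
by case: ifP => _ x /IHn[].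
Qed.

Let cellD n n' k A l t : cell (n + n') k A l t `<=` cell n k A l t.
Proof.
elim: n k A l => [|n IHn] k A l /=; first exact: cell_sub.
by case: ifP => _; exact: IHn.
Qed.

Let cell_bit n k A l t x y i : cell n k A l t x -> cell n k A l t y ->
  (k <= i < k + n)%N -> bit i x = bit i y.
Proof.
elim: n k A l => [|n IHn] k A l /=.
  by rewrite addn0 ltnNge => _ _ /andP[->].
rewrite addnS -addSn [(k <= i)%N]leq_eqVlt.
case: ifP => _ cx cy /andP[/predU1P[<-|ki] ikn].
- by rewrite (cell_sub cx).2 (cell_sub cy).2.
- by apply: IHn cx cy _; rewrite ki.
- by rewrite (negbTE (cell_sub cx).2) (negbTE (cell_sub cy).2).
- by apply: IHn cx cy _; rewrite ki.
Qed.

Let cell_neq0 n k A (l t : R) : l <= t < l + m A -> cell n k A l t !=set0.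
Proof.
elim: n k A l => [|n IHn] k A l /= /andP[lt tlA].
  apply/set0P/eqP => A0; move: tlA; rewrite A0 m0 addr0; lra.
case: ifPn => tT; apply: IHn; first by rewrite lt.
by rewrite leNgt tT/= -addrA -m_split.
Qed.

(** This is an upper Riemann sum. On a final cell h exceeds its value at the representative by at
    most e, so positivity bounds the contribution of the cell by that value plus e, times the mass,
    which is the length of the cell's interval. Finite additivity of [Lam] adds up the cells. *)
Let le_Lam_cell (h : R3 R -> R) (e : R) n k (A : set (R3 R)) (l : R) :
  bounded h -> (forall x, 0 <= h x) -> 0 <= e ->
  (forall x y, A x -> A y ->
     (forall i, (k <= i < k + n)%N -> bit i x = bit i y) -> h x <= h y + e) ->
  ((Lam (fun x => h x * \1_A x))%:E <=
   \int[@lebesgue_measure R]_(t in `[l, (l + m A)%R[)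
     (h (repr (cell n k A l t)) + e)%:E)%E.
Proof.
move=> bh h0 e0.
have mh n' k' A' l' : measurable_fun [set: measurableTypeR R]
    (fun t => (h (repr (cell n' k' A' l' t)) + e)%:E).
  apply/measurable_EFinP/measurable_funD => //.
  exact: (measurable_cell (h \o repr)).
elim: n k A l => [|n IHn] k A l hA.
  rewrite /= integral_cst//= lebesgue_measure_itv/= lte_fin.
  have -> : (if l < l + m A then ((l + m A)%:E - l%:E)%E else 0%E) = (m A)%:E.
    case: ifPn => [_|]; first by rewrite -EFinB; congr EFin; ring.
    rewrite -leNgt => ?; congr EFin; have := m_ge0 A; lra.
  rewrite -EFinM lee_fin -LamZ//; apply: Lam_le => [||x].
  - exact: boundedM.
  - exact: boundedM.
  rewrite indicE; have [xA|] := boolP (x \in A); last by rewrite !mulr0.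
  rewrite !mulr1; apply: hA; [exact/set_mem|apply: (@xgetPex _ _ A)|].
    by exists x; exact/set_mem.
  by move=> i; rewrite addn0 ltnNge => /andP[->].
set c := l + m (bitT k A).
have lc : l <= c by rewrite lerDl.
have cA : c <= l + m A by rewrite (m_split k) addrA lerDl.
rewrite (Lam_split k)// EFinD.
have -> : [set` `[l, l + m A[%R] =
    ([set` `[l, c[%R] `|` [set` `[c, l + m A[%R])%classic :> set R.
  apply/seteqP; split=> t /=; rewrite !in_itv/=.
    by case: (ltP t c) => tc /andP[-> ->]; [left|right].
  by case=> /andP[? ?]; apply/andP; split; lra.
rewrite ge0_integral_setU//=; first last.
- apply/disj_setPS => t [/=]; rewrite !in_itv/= => /andP[_ tc] /andP[ct _].
  lra.
- by move=> t _; rewrite lee_fin addr_ge0.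
- exact: measurable_funTS (mh n.+1 k A l).
apply: leeD.
  apply: le_trans (IHn k.+1 (bitT k A) l _) _.
    move=> x y [Ax kx] [Ay ky] xy; apply: hA => // i.
    rewrite leq_eqVlt => /andP[/predU1P[<-|ki] ikn]; first by rewrite kx ky.
    by apply: xy; rewrite ki addSnnS.
  rewrite le_eqVlt; apply/orP; left; apply/eqP/eq_integral => t.
  by rewrite inE/= in_itv/= => /andP[_ tc]; rewrite tc.
apply: le_trans (IHn k.+1 (bitF k A) c _) _.
  move=> x y [Ax kx] [Ay ky] xy; apply: hA => // i.
  rewrite leq_eqVlt => /andP[/predU1P[<-|ki] ikn].
    by rewrite (negbTE kx) (negbTE ky).
  by apply: xy; rewrite ki addSnnS.
rewrite /c -addrA -m_split.
rewrite le_eqVlt; apply/orP; left; apply/eqP/eq_integral => t.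
by rewrite inE/= in_itv/= => /andP[ct _]; rewrite ltNge ct.
Qed.

Let Zn n t := repr (cell n 0 setT 0 t).

Let Zn_bit n n' t j : 0 <= t < m setT -> (n <= n')%N -> (j < n)%N ->
  bit j (Zn n t) = bit j (Zn n' t).
Proof.
move=> tm nn' jn; have cZ k : cell k 0 setT 0 t (Zn k t).
  by apply: (@xgetPex _ _ (cell k 0 setT 0 t)); apply: cell_neq0; rewrite add0r.
apply: (cell_bit (cZ n)) => //; apply: (@cellD _ (n' - n)).
by rewrite subnKC.
Qed.

(* Outside [D] the representatives are unbounded, hence leave every cube for
   good, and functions vanishing at infinity tend to 0 along them. *)
Let D : set (measurableTypeR R) := [set` `[0, m setT[%R] `&`
  \bigcup_M \bigcap_(n in [set n | (M <= n)%N]) \bigcap_i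
    [set t | `|coord3 i (Zn n t)| <= M%:R].

Let measurable_coord_Zn i n :
  measurable_fun [set: measurableTypeR R] (fun t => coord3 i (Zn n t)).
Proof. exact: (measurable_cell (@coord3 R i \o repr)). Qed.

Let mD : measurable D.
Proof.
apply: measurableI; first exact: measurable_itv.
apply: bigcupT_measurable => M; apply: bigcap_measurable => [|n _].
  by exists M => /=.
apply: bigcap_measurable => [|i _]; first by exists 0%N.
rewrite -[X in measurable X]setTI.
have := @measurable_fun_ler _ _ R setT
  (fun t => `|coord3 i (Zn n t)|) (fun=> M%:R).
move=> /(_ _ _ measurableT [set true])/=; apply => //.
exact: (measurableT_comp (@normr_measurable _ _) (measurable_coord_Zn i n)).
Qed.

(** The factor [\1_D t] makes the sequence converge for every t, so that its limit is a measurable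
    function on the whole line. *)
Let vn i n t : R := coord3 i (Zn n t) * \1_D t.

Let cvg_vn i t : cvgn (vn i ^~ t).
Proof.
have vnE n : vn i n t = coord3 i (Zn n t) * (t \in D)%:R by rewrite /vn indicE.
have [tD|tD] := boolP (t \in D); last first.
  rewrite (_ : vn i ^~ t = cst 0); first exact: is_cvg_cst.
  by apply/funext => n; rewrite vnE (negbTE tD) mulr0.
rewrite (_ : vn i ^~ t = fun n => coord3 i (Zn n t)); last first.
  by apply/funext => n; rewrite vnE tD mulr1.
have [/=] := set_mem tD; rewrite in_itv/= => tm [M _ tM].
apply/cauchy_cvgP/cauchy_exP => e e0.
have [k0 _ kP] := near_infty_natSinv_lt (PosNum e0).
(* Taking k >= M excludes the alternative of [bits_grid] in which both points are far away, since
   the coordinates are bounded by M. *)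
pose k := maxn k0 M; have [n1 nP] := bits_grid R k.
exists (coord3 i (Zn (maxn n1 M) t)).
exists (maxn n1 M) => // n /= nn; rewrite /ball/=.
have [|le|[+ _]] := nP (Zn (maxn n1 M) t) (Zn n t) _ i.
- by move=> j jn1; apply: Zn_bit => //; rewrite (leq_trans jn1)// leq_maxl.
- by apply: le_lt_trans le (kP _ _); rewrite /= leq_maxl.
- move=> kM; exfalso; have := tM (maxn n1 M) (leq_maxr _ _) i I => /= uM.
  have := le_trans kM uM; rewrite ler_nat ltnNge => /negP; apply.
  exact: leq_maxr.
Qed.

Let Z t : R3 R := (limn (vn 0 ^~ t), limn (vn 1 ^~ t), limn (vn 2 ^~ t)).

Let mZ : measurable_fun [set: measurableTypeR R] Z.
Proof.
have ml i : measurable_fun [set: measurableTypeR R] (fun t => limn (vn i ^~ t)).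
  apply: (@measurable_fun_cvg _ _ _ _ (vn i)) => [n|t _]; last exact: cvg_vn.
  apply: measurable_funM; first exact: measurable_coord_Zn.
  exact: (@measurable_indic _ (measurableTypeR R) R _ _ mD).
apply: measurable_fun_pair; last exact: ml.
by apply: measurable_fun_pair; exact: ml.
Qed.

(** The depth n does not depend on t. Passing to a deeper representative costs e because the first n
    bits agree. On [D] a deep one is close to Z t, which costs another e; off [D] some deeper one
    lies so far out that h is at most e there. *)
Let le_h_Zn (h : R3 R -> R) (e : R) : uniform_C0 h -> (forall x, 0 <= h x) ->
  0 < e -> exists n, (forall x y : R3 R,
    (forall j, (j < n)%N -> bit j x = bit j y) -> `|h x - h y| <= e) /\
    forall t, 0 <= t < m setT -> h (Zn n t) <= h (Z t) * \1_D t + 2 * e.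
Proof.
move=> hC h0 e0; have [n nP] := uniform_C0_bits hC e0.
exists n; split => // t tm.
have hnn' n' : (n <= n')%N -> `|h (Zn n t) - h (Zn n' t)| <= e.
  by move=> nn'; apply: nP => j jn; exact: Zn_bit.
have [k [k1 k2]] := hC _ e0; rewrite indicE.
have [/set_mem Dt|Dt] := boolP (t \in D); last first.
  suff [n' [nn' hn']] : exists n', (n <= n')%N /\ `|h (Zn n' t)| <= e.
    by have := hnn' _ nn'; move: hn'; rewrite !ler_norml mulr0 => *; lra.
  apply: contrapT => Dn; move/negP: Dt; apply; apply/mem_set; split.
    by rewrite /= in_itv.
  exists (maxn n k.+1) => // n' /= nn' i _ /=; rewrite leNgt; apply/negP => lu.
  apply: Dn; exists n'; split; first exact: (leq_trans (leq_maxl _ _) nn').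
  apply: (k2 _ i); apply: le_trans (ltW lu).
  by rewrite ler_nat leq_maxr.
have near_coord i : \forall n' \near \oo,
    `|coord3 i (Zn n' t) - limn (vn i ^~ t)| <= k.+1%:R^-1.
  have /cvgrPdist_le := @cvg_vn i t.
  have kV : (0 : R) < k.+1%:R^-1 by rewrite invr_gt0.
  move=> /(_ _ kV); apply: filterS => n'.
  by rewrite /vn indicE mem_set// mulr1 distrC.
have : \forall n' \near \oo, (n <= n')%N /\
    forall i, `|coord3 i (Zn n' t) - coord3 i (Z t)| <= k.+1%:R^-1.
  near=> n'; split; first by near: n'; exact: nbhs_infty_ge.
  have n0 : `|coord3 0 (Zn n' t) - coord3 0 (Z t)| <= k.+1%:R^-1.
    by near: n'; exact: (near_coord 0).
  have n1 : `|coord3 1 (Zn n' t) - coord3 1 (Z t)| <= k.+1%:R^-1.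
    by near: n'; exact: (near_coord 1).
  have n2 : `|coord3 2 (Zn n' t) - coord3 2 (Z t)| <= k.+1%:R^-1.
    by near: n'; exact: (near_coord 2).
  by case=> [|[|i]].
move=> [n' _ /(_ n' (leqnn _))[nn' /k1]].
by have := hnn' _ nn'; rewrite !ler_norml mulr1 => *; lra.
Unshelve. all: by end_near. Qed.

Theorem riesz_C0 : exists Z : measurableTypeR R -> R3 R,
  measurable_fun setT Z /\
  forall h : R3 R -> R, measurable_fun setT h -> bounded h ->
    uniform_C0 h -> (forall x, 0 <= h x) ->
    ((Lam h)%:E <= \int[@lebesgue_measure R]_(t in `[0%R, N[) (h (Z t))%:E)%E.
Proof.
exists Z; split => //.
move=> h measurable_h bh hC h0; apply/lee_addgt0Pr => e e0.
(* The Riemann sum costs e' and the passage to Z costs 2 e', over an interval of length [m setT];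
   adding 1 covers the case of zero mass. *)
pose e' := e / (3 * (m setT + 1)).
have mT0 := m_ge0 setT.
have e'0 : 0 < e' by rewrite divr_gt0// mulr_gt0//; lra.
have [n [nP hn]] := le_h_Zn hC h0 e'0.
have mh n' : measurable_fun [set: measurableTypeR R] (fun t => h (Zn n' t)).
  exact: (measurable_cell (h \o repr)).
have mhZ : measurable_fun [set: measurableTypeR R]
    (fun t => (h (Z t) * \1_D t)%:E).
  apply/measurable_EFinP/measurable_funM; last first.
    exact: (@measurable_indic _ (measurableTypeR R) R _ _ mD).
  exact: (measurableT_comp measurable_h mZ).
have -> : Lam h = Lam (fun x => h x * \1_setT x).
  by congr Lam; apply/funext => x; rewrite indicT mulr1.
have := @le_Lam_cell h e' n 0 setT 0 bh h0 (ltW e'0).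
rewrite add0r => H; apply: le_trans (H _) _.
  move=> x y _ _ xy; have := nP x y; rewrite ler_norml => /(_ _)/andP[].
    by move=> j jn; apply: xy.
  lra.
apply: (@le_trans _ _ (\int[@lebesgue_measure R]_(t in `[0%R, m setT[)
   ((h (Z t) * \1_D t)%:E + (3 * e')%:E))%E).
  apply: ge0_le_integral => //=.
  - by move=> t _; rewrite lee_fin addr_ge0// ltW.
  - apply/measurable_EFinP/measurable_funD => //.
    exact: (measurable_funTS (mh n)).
  - by apply: emeasurable_funD => //; exact: (measurable_funTS mhZ).
  - move=> t; rewrite in_itv/= => /hn ?; rewrite -EFinD lee_fin; lra.
rewrite ge0_integralD//=; last 3 first.
- by move=> t _; rewrite lee_fin mulr_ge0.
- exact: (measurable_funTS mhZ).
- by move=> t _; rewrite lee_fin; lra.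
rewrite integral_cst//= lebesgue_measure_itv/= lte_fin.
have -> : (if 0 < m setT then ((m setT)%:E - 0%:E)%E else 0%E) = (m setT)%:E.
  by case: ltP => [_|?]; [rewrite sube0|congr EFin; lra].
apply: leeD; last first.
  rewrite -EFinM lee_fin /e'.
  rewrite (_ : _ * m setT = e * (m setT / (m setT + 1))); last by field; lra.
  by rewrite ger_pMr// ler_pdivrMr; lra.
(* The parameters in [m setT, N) bring the mass up to N; as h >= 0 they can only increase the
   integral. *)
have mN : m setT <= N by rewrite /m indicT.
apply: (@le_trans _ _ (\int[@lebesgue_measure R]_(t in `[0%R, N[)
    (h (Z t) * \1_D t)%:E)%E).
  apply: ge0_subset_integral => //=.
  - exact: (measurable_funTS mhZ).
  - by move=> t _; rewrite lee_fin mulr_ge0.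
  - by move=> t /=; rewrite !in_itv/= => /andP[-> tm]; exact: lt_le_trans mN.
apply: ge0_le_integral => //=.
- by move=> t _; rewrite lee_fin mulr_ge0.
- exact: (measurable_funTS mhZ).
- apply/measurable_EFinP/measurable_funTS.
  exact: (measurableT_comp measurable_h mZ).
- by move=> t _; rewrite lee_fin -[leRHS]mulr1 ler_wpM2l.
Qed.

End riesz.

(** * The truncated kernel *)

Section leb3.
Local Open Scope ereal_scope.

Lemma leb3E (R : realType) (A B C : set (measurableTypeR R)) :
  measurable A -> measurable B -> measurable C ->
  leb3 R (A `*` B `*` C) =
  @lebesgue_measure R A * @lebesgue_measure R B * @lebesgue_measure R C.
Proof.
move=> mA mB mC.
rewrite [LHS](@product_measure1E _ _ _ _ _
  (@lebesgue_measure R \x @lebesgue_measure R) (@lebesgue_measure R))//;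
  last exact: measurableX.
by congr (_ * _); exact: product_measure1E.
Qed.

Definition cube (R : realType) (y : R3 R) (r : R) : set (R3 R) :=
  `[(y.1.1 - r)%R, (y.1.1 + r)%R] `*` `[(y.1.2 - r)%R, (y.1.2 + r)%R]
  `*` `[(y.2 - r)%R, (y.2 + r)%R].

Lemma measurable_cube (R : realType) (y : R3 R) r : measurable (cube y r).
Proof. by apply: measurableX; [apply: measurableX|]; exact: measurable_itv. Qed.

Lemma leb3_cube (R : realType) (y : R3 R) (r : R) : (0 <= r)%R ->
  leb3 R (cube y r) = ((2 * r) ^+ 3)%:E.
Proof.
move=> r0; have l z : @lebesgue_measure R `[(z - r)%R, (z + r)%R] = (2 * r)%:E.
  rewrite lebesgue_measure_itv/= lte_fin.
  case: ltP => h; last by congr EFin; lra.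
  by rewrite -EFinD; congr EFin; lra.
rewrite [LHS]leb3E//; rewrite !l -!EFinM; congr EFin; ring.
Qed.

(* Alias of [leb3] carrying the sigma-finite structure: canonical inference does
   not find that structure on a product measure. *)
Definition leb3s (R : realType) : set (R3 R) -> \bar R := leb3 R.

HB.instance Definition _ (R : realType) := Measure.on (@leb3s R).

Lemma sigma_finite_leb3 (R : realType) : sigma_finite setT (@leb3s R).
Proof.
exists (fun n => cube (0%R, 0%R, 0%R) n%:R).
  apply/esym/seteqP; split=> // x _.
  pose n := Num.truncn (`|x.1.1| + `|x.1.2| + `|x.2|)%R.
  exists n.+1 => //; have xn : (`|x.1.1| + `|x.1.2| + `|x.2| <= n.+1%:R)%R.
    exact/ltW/truncnS_gt.
  have := normr_ge0 x.1.1; have := normr_ge0 x.1.2; have := normr_ge0 x.2.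
  move=> h2 h1 h0.
  by split; [split|]; rewrite /= in_itv/= sub0r add0r -ler_norml; lra.
move=> n; rewrite [leb3s _]leb3_cube// ltry; split => //.
exact: measurable_cube.
Qed.

HB.instance Definition _ (R : realType) :=
  Measure_isSigmaFinite.Build _ _ _ (@leb3s R) (@sigma_finite_leb3 R).

Lemma tonelli3 (R : realType) (f : measurableTypeR R * R3 R -> \bar R) :
  measurable_fun setT f -> (forall z, 0 <= f z) ->
  \int[@lebesgue_measure R]_t \int[leb3 R]_x f (t, x) =
  \int[leb3 R]_x \int[@lebesgue_measure R]_t f (t, x).
Proof. exact: (@fubini_tonelli _ _ _ _ R (@lebesgue_measure R) (@leb3s R)). Qed.

End leb3.

Lemma dist3_ge0 (R : realType) (x y : R3 R) : 0 <= dist3 x y.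
Proof. exact: sqrtr_ge0. Qed.

Lemma coord3_le_dist3 (R : realType) (x y : R3 R) i :
  `|coord3 i x - coord3 i y| <= dist3 x y.
Proof.
have le_sqrt (a b : R) : a ^+ 2 <= b -> `|a| <= Num.sqrt b.
  by move=> ab; rewrite -sqrtr_sqr ler_wsqrtr.
rewrite /dist3; case: i => [|[|i]] /=; apply: le_sqrt;
  set a := (x.1.1 - _) ^+ 2; set b := (x.1.2 - _) ^+ 2; set c := (x.2 - _) ^+ 2;
  have := sqr_ge0 (x.1.1 - y.1.1); have := sqr_ge0 (x.1.2 - y.1.2);
  have := sqr_ge0 (x.2 - y.2); rewrite -/a -/b -/c; lra.
Qed.

(** After squaring, what remains is b (a - b) <= sqrt (s + b^2) |a - b|. This is the triangle
    inequality for a change of one coordinate. *)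
Lemma sqrtD_sqr_le (R : realType) (s a b : R) : 0 <= s ->
  Num.sqrt (s + a ^+ 2) <= Num.sqrt (s + b ^+ 2) + `|a - b|.
Proof.
move=> s0; have p0 : 0 <= s + b ^+ 2 by rewrite addr_ge0// sqr_ge0.
have q0 : 0 <= s + a ^+ 2 by rewrite addr_ge0// sqr_ge0.
rewrite -ler_sqr ?nnegrE ?addr_ge0 ?sqrtr_ge0//.
rewrite sqr_sqrtr// sqrrD sqr_sqrtr// real_normK ?num_real//.
have bS : `|b| <= Num.sqrt (s + b ^+ 2).
  by rewrite -sqrtr_sqr ler_wsqrtr// lerDr.
have : b * (a - b) <= Num.sqrt (s + b ^+ 2) * `|a - b|.
  by apply: le_trans (ler_norm _) _; rewrite normrM ler_wpM2r.
rewrite -mulr_natl; set q := Num.sqrt _ * _; lra.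
Qed.

(** The coordinates are changed one at a time, each at a cost of e, whence the factor 3. *)
Lemma dist3_lipschitz (R : realType) (x y z : R3 R) (e : R) :
  (forall i, `|coord3 i y - coord3 i z| <= e) ->
  dist3 x y <= dist3 x z + 3 * e.
Proof.
move=> yz; have := yz 0; have := yz 1; have := yz 2; rewrite /= /dist3.
set a := x.1.1 - y.1.1; set b := x.1.2 - y.1.2; set c := x.2 - y.2.
set a' := x.1.1 - z.1.1; set b' := x.1.2 - z.1.2; set c' := x.2 - z.2.
have -> : y.1.1 - z.1.1 = - (a - a') by rewrite /a /a'; ring.
have -> : y.1.2 - z.1.2 = - (b - b') by rewrite /b /b'; ring.
have -> : y.2 - z.2 = - (c - c') by rewrite /c /c'; ring.
rewrite !normrN => h2 h1 h0.
have s2 u v : 0 <= u ^+ 2 + v ^+ 2 :> R by rewrite addr_ge0// sqr_ge0.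
have := sqrtD_sqr_le c c' (s2 a b).
have := sqrtD_sqr_le b b' (s2 a c'); have := sqrtD_sqr_le a a' (s2 b' c').
rewrite [b' ^+ 2 + _ + a ^+ 2]addrC [b' ^+ 2 + _ + a' ^+ 2]addrC !addrA.
rewrite ![a ^+ 2 + c' ^+ 2 + _]addrAC.
lra.
Qed.

Lemma measurable_dist3 (R : realType) :
  measurable_fun [set: R3 R * R3 R] (fun z : R3 R * R3 R => dist3 z.1 z.2).
Proof.
have mc i : measurable_fun [set: R3 R * R3 R]
    (fun z : R3 R * R3 R => (coord3 i z.1 - coord3 i z.2) ^+ 2).
  apply/measurable_funX/measurable_funB.
    exact: (measurableT_comp (measurable_coord3 i) measurable_fst).
  exact: (measurableT_comp (measurable_coord3 i) measurable_snd).
apply: (measurableT_comp (continuous_measurable_fun (@sqrt_continuous R))).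
apply: measurable_funD; last exact: (mc 2).
by apply: measurable_funD; [exact: (mc 0)|exact: (mc 1)].
Qed.

(** The kernel cut off at height 2^K is bounded and Lipschitz in y. Dyadic heights make the errors
    of successive truncated potentials a geometric series. *)
Definition trunc_kernel (R : realType) (K : nat) (x y : R3 R) : R :=
  (Num.max (dist3 x y) (2 ^+ K)^-1)^-1.

Section trunc_kernel.
Context {R : realType}.
Implicit Types x y z : R3 R.

Let pow2_gt0 K : (0 : R) < 2 ^+ K. Proof. by rewrite exprn_gt0. Qed.

Let max_gt0 K x y : 0 < Num.max (dist3 x y) (2 ^+ K)^-1.
Proof. by rewrite lt_max invr_gt0 pow2_gt0 orbT. Qed.

Lemma trunc_kernel_ge0 K x y : 0 <= trunc_kernel K x y.
Proof. by rewrite invr_ge0 ltW. Qed.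

Lemma trunc_kernel_le K x y : trunc_kernel K x y <= 2 ^+ K.
Proof.
by rewrite -[leRHS]invrK lef_pV2 ?posrE ?invr_gt0// le_max lexx orbT.
Qed.

Lemma measurable_trunc_kernel K :
  measurable_fun [set: R3 R * R3 R]
    (fun z : R3 R * R3 R => trunc_kernel K z.1 z.2).
Proof.
rewrite (_ : (fun _ => _) =
    (fun z : R3 R * R3 R => (Num.max (dist3 z.1 z.2) (2 ^+ K)^-1) `^ (-1))).
  apply: (measurableT_comp (measurable_powR (-1))).
  by apply: measurable_maxr => //; exact: measurable_dist3.
by apply/funext => z; rewrite powR_inv1// ltW.
Qed.

Lemma trunc_kernelS K x y : trunc_kernel K x y <= trunc_kernel K.+1 x y.
Proof.
rewrite lef_pV2 ?posrE// ge_max !le_max lexx/=; apply/orP; right.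
by rewrite lef_pV2 ?posrE// ler_eXn2l// ltr1n.
Qed.

(** Truncation changes nothing at distance at least 2^-K. Closer in, the next kernel is at most
    2^(K+1), and the ball lies in the cube. *)
Lemma trunc_kernelS_le K x y : trunc_kernel K.+1 x y <=
  trunc_kernel K x y + 2 ^+ K.+1 * \1_(cube y (2 ^+ K)^-1) x.
Proof.
have [Kd|dK] := leP (2 ^+ K)^-1 (dist3 x y).
  rewrite {2}/trunc_kernel (max_idPl Kd).
  apply: (@le_trans _ _ (dist3 x y)^-1); last first.
    by rewrite lerDl mulr_ge0// ltW.
  rewrite lef_pV2 ?posrE//; last by apply: lt_le_trans Kd; rewrite invr_gt0.
  by rewrite le_max lexx.
have xy i : `|coord3 i x - coord3 i y| <= (2 ^+ K)^-1.
  exact: le_trans (coord3_le_dist3 _ _ _) (ltW dK).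
rewrite indicE mem_set ?mulr1.
  by apply: le_trans (trunc_kernel_le _ _ _) _; rewrite lerDr trunc_kernel_ge0.
have := xy 0; have := xy 1; have := xy 2; rewrite /= !ler_distl => ? ? ?.
by split; [split|]; rewrite /= in_itv.
Qed.

(** Inversion is Lipschitz away from 0: 1/a - 1/b = (b - a) / (a b), where 1/a and 1/b are at most
    2^K. Hence the factor 4^K. *)
Lemma trunc_kernel_lipschitz K x y z (e : R) :
  (forall i, `|coord3 i y - coord3 i z| <= e) ->
  trunc_kernel K x y <= trunc_kernel K x z + 4 ^+ K * (3 * e).
Proof.
move=> yz; have e0 : 0 <= e by apply: le_trans (yz 0).
have zy i : `|coord3 i z - coord3 i y| <= e by rewrite distrC.
have := dist3_lipschitz x zy; rewrite /trunc_kernel.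
set a := Num.max (dist3 x y) _; set b := Num.max (dist3 x z) _ => d.
have ab : b <= a + 3 * e.
  rewrite ge_max; apply/andP; split.
    by apply: le_trans d _; rewrite lerD2r le_max lexx.
  by rewrite -[leLHS]addr0 lerD ?mulr_ge0// le_max lexx orbT.
have a0 : 0 < a by exact: max_gt0.
have b0 : 0 < b by exact: max_gt0.
have aK : a^-1 <= 2 ^+ K by exact: trunc_kernel_le.
have bK : b^-1 <= 2 ^+ K by exact: trunc_kernel_le.
rewrite -lerBlDl (_ : a^-1 - b^-1 = a^-1 * b^-1 * (b - a)); last first.
  by field; rewrite !gt_eqF.
apply: (@le_trans _ _ (a^-1 * b^-1 * (3 * e))).
  by rewrite ler_wpM2l ?mulr_ge0 ?invr_ge0 ?(ltW a0) ?(ltW b0)//; lra.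
rewrite ler_wpM2r ?mulr_ge0//.
rewrite (_ : 4 = 2 * 2 :> R) ?exprMn; last by ring.
by rewrite ler_pM ?invr_ge0 ?(ltW a0) ?(ltW b0).
Qed.

Lemma trunc_kernel_le_riesz K x y :
  ((trunc_kernel K x y)%:E <= riesz_kernel x y)%E.
Proof.
rewrite /riesz_kernel inver; case: eqP => [_|/eqP d0]; first exact: leey.
rewrite lee_fin lef_pV2 ?posrE//; first by rewrite le_max lexx.
by rewrite lt_neqAle eq_sym d0 dist3_ge0.
Qed.

Lemma cvg_trunc_kernel x y :
  (trunc_kernel K x y)%:E @[K --> \oo] --> riesz_kernel x y.
Proof.
rewrite /riesz_kernel inver; case: eqP => [d0|/eqP d0].
  apply/cvgeryP; rewrite /trunc_kernel d0.
  apply/cvgryPge => A.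
  exists (Num.truncn A).+1 => // K /= AK.
  rewrite (max_idPr _) ?invr_ge0 ?(ltW (pow2_gt0 K))// invrK.
  apply: (@le_trans _ _ K%:R); last by rewrite -natrX ler_nat ltnW// ltn_expl.
  apply: (@le_trans _ _ (Num.truncn A).+1%:R); last by rewrite ler_nat.
  exact/ltW/truncnS_gt.
have d1 : 0 < dist3 x y by rewrite lt_neqAle eq_sym d0 dist3_ge0.
apply: cvg_near_cst; have [n _ nP] := near_infty_natSinv_expn_lt (PosNum d1).
exists n => // K /= nK; congr EFin; rewrite /trunc_kernel (max_idPl _)//.
by have /ltW := nP _ nK; rewrite /= div1r.
Qed.

Lemma measurable_riesz_kernel :
  measurable_fun [set: R3 R * R3 R]
    (fun z : R3 R * R3 R => riesz_kernel z.1 z.2).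
Proof.
apply: (@emeasurable_fun_cvg _ _ _ _
    (fun K (z : R3 R * R3 R) => (trunc_kernel K z.1 z.2)%:E)) => [K|z _].
  by apply/measurable_EFinP; exact: measurable_trunc_kernel.
exact: cvg_trunc_kernel.
Qed.

Lemma riesz_kernel_ge0 x y : (0 <= riesz_kernel x y)%E.
Proof.
apply: le_trans (trunc_kernel_le_riesz 0 x y).
by rewrite lee_fin trunc_kernel_ge0.
Qed.

End trunc_kernel.

(** * Potentials of test functions *)

(** A single M bounds both the height and the support. The class is a convex cone, as the functional
    p requires, and contains the indicators of bounded Borel sets, which suffice to compare
    functions almost everywhere. *)
Definition test_function (R : realType) (f : R3 R -> R) :=
  [/\ measurable_fun setT f, forall x, 0 <= f x &
    exists2 M : R, 0 <= M & forall x, f x <= M * \1_(cube (0, 0, 0) M) x].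

Definition potential (R : realType) (f : R3 R -> R) (y : R3 R) : \bar R :=
  (\int[leb3 R]_x ((f x)%:E * riesz_kernel x y))%E.

Section potential.
Context {R : realType}.
Implicit Types (f g : R3 R -> R) (x y z : R3 R).

Lemma measurable_trunc_kernel_l K y :
  measurable_fun [set: R3 R] (fun x => trunc_kernel K x y).
Proof. exact: (measurable_fun_pair1 y (measurable_trunc_kernel K)). Qed.

Lemma measurable_riesz_kernel_l y :
  measurable_fun [set: R3 R] (fun x => riesz_kernel x y).
Proof. exact: (measurable_fun_pair1 y (@measurable_riesz_kernel R)). Qed.

Lemma potential_ge0 f y : (forall x, 0 <= f x) -> (0 <= potential f y)%E.
Proof.
move=> f0; apply: integral_ge0 => x _.
by rewrite mule_ge0 ?lee_fin ?riesz_kernel_ge0.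
Qed.

Lemma measurable_potential_integrand f y : measurable_fun setT f ->
  measurable_fun setT (fun x => ((f x)%:E * riesz_kernel x y)%E).
Proof.
move=> mf; apply: emeasurable_funM; first exact/measurable_EFinP.
exact: measurable_riesz_kernel_l.
Qed.

Lemma potentialD f g y : measurable_fun setT f -> measurable_fun setT g ->
  (forall x, 0 <= f x) -> (forall x, 0 <= g x) ->
  potential (fun x => f x + g x) y = (potential f y + potential g y)%E.
Proof.
move=> mf mg f0 g0; rewrite /potential -ge0_integralD//.
- apply: eq_integral => x _; rewrite EFinD ge0_muleDl ?lee_fin//.
- by move=> x _; rewrite mule_ge0 ?lee_fin ?riesz_kernel_ge0.
- exact: measurable_potential_integrand.
- by move=> x _; rewrite mule_ge0 ?lee_fin ?riesz_kernel_ge0.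
- exact: measurable_potential_integrand.
Qed.

Lemma potentialZ (a : R) f y : 0 <= a -> measurable_fun setT f ->
  (forall x, 0 <= f x) ->
  potential (fun x => a * f x) y = (a%:E * potential f y)%E.
Proof.
move=> a0 mf f0; rewrite /potential -ge0_integralZl//.
- by apply: eq_integral => x _; rewrite EFinM muleA.
- exact: measurable_potential_integrand.
- by move=> x _; rewrite mule_ge0 ?lee_fin ?riesz_kernel_ge0.
Qed.

Section test_function_potential.
Variables (f : R3 R -> R) (M : R).
Hypotheses (mf : measurable_fun setT f) (f0 : forall x, 0 <= f x) (M0 : 0 <= M)
  (fM : forall x, f x <= M * \1_(cube (0, 0, 0) M) x).

Let leM x : f x <= M.
Proof.
by apply: le_trans (fM x) _; rewrite -[leRHS]mulr1 ler_wpM2l.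
Qed.

Let f_out x i : M < `|coord3 i x| -> f x = 0.
Proof.
move=> Mx; apply/eqP; rewrite eq_le f0 andbT; apply: le_trans (fM x) _.
rewrite indicE memNset ?mulr0// => -[[/=]].
rewrite !in_itv/= !sub0r !add0r -!ler_norml => h0 h1 h2.
by move: Mx; case: i => [|[|i]] /=; rewrite ltNge ?h0 ?h1 ?h2.
Qed.

Let trunc_pot K y := (\int[leb3 R]_x (f x * trunc_kernel K x y)%:E)%E.

Let m_trunc K y : measurable_fun [set: R3 R]
  (fun x => (f x * trunc_kernel K x y)%:E).
Proof.
apply/measurable_EFinP/measurable_funM => //.
exact: measurable_trunc_kernel_l.
Qed.

Let trunc_ge0 K x y : (0 <= (f x * trunc_kernel K x y)%:E)%E.
Proof. by rewrite lee_fin mulr_ge0// trunc_kernel_ge0. Qed.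

Let C := M * (2 * M) ^+ 3.

Let C0 : 0 <= C. Proof. by rewrite mulr_ge0// exprn_ge0// mulr_ge0. Qed.

Let integral_cube (a : R) y (r : R) : 0 <= a -> 0 <= r ->
  (\int[leb3 R]_x (a * \1_(cube y r) x)%:E = (a * (2 * r) ^+ 3)%:E)%E.
Proof.
move=> a0 r0; have mc : measurable (cube y r) by exact: measurable_cube.
have mi : measurable_fun [set: R3 R] (fun x => (\1_(cube y r) x : R)%:E).
  by apply/measurable_EFinP; exact: measurable_indic.
transitivity (\int[leb3 R]_x (a%:E * (\1_(cube y r) x : R)%:E))%E.
  by apply: eq_integral => x _; rewrite EFinM.
rewrite (ge0_integralZl _ measurableT mi)//.
by rewrite integral_indic// setIT EFinM; congr (_ * _)%E; exact: leb3_cube.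
Qed.

Let integral_f : (\int[leb3 R]_x (f x)%:E <= C%:E)%E.
Proof.
rewrite -(integral_cube (0, 0, 0) M0 M0); apply: ge0_le_integral => //.
- by move=> x _; rewrite lee_fin.
- exact/measurable_EFinP.
- apply/measurable_EFinP/measurable_funM => //.
  by apply: measurable_indic; exact: measurable_cube.
- by move=> x _; rewrite lee_fin.
Qed.

(* On the layer [dist3 x y < 2^-K] the kernel gains at most [2^(K+1)], and this
   layer has volume at most [8 * 8^-K]. *)
Let trunc_potS K y :
  (trunc_pot K.+1 y <= trunc_pot K y + (16 * M * (4 ^+ K)^-1)%:E)%E.
Proof.
have r0 : (0 : R) <= (2 ^+ K)^-1 by rewrite invr_ge0 exprn_ge0.
have a0 : 0 <= M * 2 ^+ K.+1 by rewrite mulr_ge0// exprn_ge0.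
have mcub : measurable_fun [set: R3 R]
    (fun x => (M * 2 ^+ K.+1 * \1_(cube y (2 ^+ K)^-1) x)%:E).
  apply/measurable_EFinP/measurable_funM => //.
  by apply: measurable_indic; exact: measurable_cube.
apply: (@le_trans _ _ (\int[leb3 R]_x ((f x * trunc_kernel K x y)%:E +
   (M * 2 ^+ K.+1 * \1_(cube y (2 ^+ K)^-1) x)%:E))%E).
  apply: ge0_le_integral => //.
  - by apply: emeasurable_funD => //; exact: m_trunc.
  - move=> x _; rewrite -EFinD lee_fin.
    apply: le_trans (ler_wpM2l (f0 x) (trunc_kernelS_le K x y)) _.
    by rewrite mulrDr lerD2l -mulrA ler_wpM2r// mulr_ge0// exprn_ge0.
rewrite ge0_integralD//; last by move=> x _; rewrite lee_fin mulr_ge0.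
rewrite integral_cube// leeD2l// lee_fin.
rewrite (_ : 4 = 2 * 2 :> R); last by ring.
rewrite [in leRHS]exprMn exprS le_eqVlt; apply/orP; left; apply/eqP.
have : (2 : R) ^+ K != 0 by rewrite expf_neq0.
by move: (2 ^+ K) => u u0; field.
Qed.

(** Telescoping of the one-step bound. The constant 32 absorbs each step because 32 (1 - 1/4) >=
    16. *)
Let trunc_pot_tail K j y :
  (trunc_pot (K + j) y <=
   trunc_pot K y + (32 * M * (4 ^+ K)^-1 - 32 * M * (4 ^+ (K + j))^-1)%:E)%E.
Proof.
elim: j => [|j IHj]; first by rewrite addn0 subrr adde0.
rewrite addnS; apply: le_trans (trunc_potS _ _) _.
apply: le_trans (leeD2r _ IHj) _.
rewrite -addeA leeD2l// -EFinD lee_fin exprS invfM.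
have q0 : 0 <= M * (4 ^+ (K + j))^-1 by rewrite mulr_ge0// invr_ge0 exprn_ge0.
by move: q0; move: (4 ^- K) (4 ^- (K + j)) => p q; lra.
Qed.

Let pot_cvg y : trunc_pot K y @[K --> \oo] --> potential f y.
Proof.
have -> : potential f y = (\int[leb3 R]_x
    limn (fun K => (f x * trunc_kernel K x y)%:E))%E.
  apply: eq_integral => x _; apply/esym/cvg_lim => //.
  under eq_cvg do rewrite EFinM.
  by apply: cvgeZl => //; exact: cvg_trunc_kernel.
apply: cvg_monotone_convergence => // x _.
apply/nondecreasing_seqP => K.
by rewrite lee_fin ler_wpM2l// trunc_kernelS.
Qed.

(** The error is uniform in y, so the Lipschitz bounds on truncated potentials make the potential
    itself uniformly continuous. *)
Let pot_le_trunc K y :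
  (potential f y <= trunc_pot K y + (32 * M * (4 ^+ K)^-1)%:E)%E.
Proof.
rewrite -(cvg_lim _ (@pot_cvg y))//; apply: lime_le.
  by apply/cvg_ex; exists (potential f y); exact: pot_cvg.
exists K => // n /= /subnKC <-; apply: le_trans (trunc_pot_tail _ _ _) _.
rewrite leeD2l// lee_fin gerBl mulr_ge0 ?mulr_ge0// invr_ge0 exprn_ge0//.
Qed.

Let trunc_le_pot K y : (trunc_pot K y <= potential f y)%E.
Proof.
apply: ge0_le_integral => //.
- exact: measurable_potential_integrand.
- by move=> x _; rewrite EFinM lee_wpmul2l ?lee_fin// trunc_kernel_le_riesz.
Qed.

Let trunc_lipschitz K y z (e : R) :
  (forall i, `|coord3 i y - coord3 i z| <= e) ->
  (trunc_pot K y <= trunc_pot K z + (4 ^+ K * (3 * e) * C)%:E)%E.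
Proof.
move=> yz; have e0 : 0 <= e by apply: le_trans (yz 0).
have a0 : 0 <= 4 ^+ K * (3 * e) by rewrite mulr_ge0 ?exprn_ge0// mulr_ge0.
apply: (@le_trans _ _ (\int[leb3 R]_x ((f x * trunc_kernel K x z)%:E +
   (4 ^+ K * (3 * e))%:E * (f x)%:E))%E).
  apply: ge0_le_integral => //.
  - apply: emeasurable_funD; first exact: m_trunc.
    by apply: emeasurable_funM => //; exact/measurable_EFinP.
  - move=> x _; rewrite -EFinM -EFinD lee_fin.
    apply: le_trans (ler_wpM2l (f0 x) (trunc_kernel_lipschitz K x yz)) _.
    by rewrite mulrDr [X in _ + X]mulrC.
rewrite ge0_integralD//; last 2 first.
- by move=> x _; rewrite mule_ge0 ?lee_fin.
- by apply: emeasurable_funM => //; exact/measurable_EFinP.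
rewrite ge0_integralZl//; last 2 first.
- exact/measurable_EFinP.
- by move=> x _; rewrite lee_fin.
by rewrite leeD2l// [leRHS]EFinM lee_wpmul2l// lee_fin.
Qed.

Let pot_bound y : (potential f y <= (C + 32 * M)%:E)%E.
Proof.
apply: le_trans (pot_le_trunc 0 y) _; rewrite expr0 invr1 mulr1 EFinD.
rewrite leeD2r//; apply: le_trans integral_f; apply: ge0_le_integral => //.
- exact/measurable_EFinP.
- move=> x _; rewrite lee_fin -[leRHS]mulr1 ler_wpM2l//.
  by have := trunc_kernel_le 0 x y; rewrite expr0.
Qed.

Let pot_fin y : (fine (potential f y))%:E = potential f y.
Proof.
rewrite fineK// ge0_fin_numE ?potential_ge0//.
exact: le_lt_trans (pot_bound y) (ltry _).
Qed.

Let pot_decay y i (r : R) : 0 < r -> M + r <= `|coord3 i y| ->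
  (potential f y <= (r^-1 * C)%:E)%E.
Proof.
move=> r0 yr.
apply: (@le_trans _ _ (\int[leb3 R]_x ((r^-1)%:E * (f x)%:E))%E).
  apply: ge0_le_integral => //.
  - by move=> x _; rewrite mule_ge0 ?lee_fin ?riesz_kernel_ge0.
  - exact: measurable_potential_integrand.
  - by apply: emeasurable_funM => //; exact/measurable_EFinP.
  move=> x _; have [xM|Mx] := leP `|coord3 i x| M; last first.
    by rewrite (f_out Mx) mul0e mule0.
  have rd : r <= dist3 x y.
    apply: le_trans (coord3_le_dist3 x y i).
    have := ler_normD (coord3 i x) (coord3 i y - coord3 i x).
    by rewrite addrC subrK [X in _ + X]distrC; lra.
  rewrite muleC lee_wpmul2r ?lee_fin// /riesz_kernel inver gt_eqF.
    by rewrite lee_fin lef_pV2 ?posrE// (lt_le_trans r0).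
  exact: lt_le_trans rd.
rewrite ge0_integralZl//; last 3 first.
- exact/measurable_EFinP.
- by move=> x _; rewrite lee_fin.
- by rewrite lee_fin invr_ge0 ltW.
by rewrite [leRHS]EFinM lee_wpmul2l// lee_fin invr_ge0 ltW.
Qed.

Let pot_uniform_C0 : uniform_C0 (fun y => fine (potential f y)).
Proof.
move=> e e0.
have [K hK] : exists K, 32 * M * (4 ^+ K)^-1 <= e / 2.
  pose n := (Num.truncn (64 * M / e)).+1.
  exists n; have nM : 64 * M / e < n%:R by exact: truncnS_gt.
  rewrite ler_pdivrMr ?exprn_gt0//.
  have n4 : n%:R <= 4 ^+ n :> R by rewrite -natrX ler_nat ltnW// ltn_expl.
  move: nM; rewrite ltr_pdivrMr// => nM.
  have : n%:R * e <= 4 ^+ n * e by rewrite ler_wpM2r// ltW.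
  lra.
(* The term 6 * 4^K * C / e makes the Lipschitz error 3 * 4^K * C / k.+1 at most e / 2. The terms 2
   * M and 2 * C / e make the decay bound C / (k.+1 - M) at most e, and the final 1 keeps its
   denominator positive. *)
pose X := 2 * M + 2 * C / e + 6 * 4 ^+ K * C / e + 1.
have p4 : (0 : R) < 4 ^+ K by rewrite exprn_gt0.
have C1 : 0 <= C / e by rewrite divr_ge0// ltW.
have C2 : 0 <= 4 ^+ K * (C / e) by rewrite mulr_ge0// ltW.
have XeE : X * e = 2 * M * e + 2 * C + 6 * 4 ^+ K * C + e.
  by rewrite /X; field; rewrite gt_eqF.
have XM : 2 * M + 1 <= X.
  rewrite /X (_ : 2 * C / e = 2 * (C / e)); last by ring.
  rewrite (_ : 6 * _ * C / e = 6 * (4 ^+ K * (C / e))); last by ring.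
  by move: C1 C2; move: (4 ^+ K * (C / e)) => p; move: (C / e) => q; lra.
pose k := Num.truncn X; exists k.
have Xk : X < k.+1%:R by exact: truncnS_gt.
have k0 : (0 : R) < k.+1%:R by rewrite ltr0n.
split=> [x y xy|y i yk].
  have half u v : (forall i, `|coord3 i u - coord3 i v| <= k.+1%:R^-1) ->
      fine (potential f u) <= fine (potential f v) + e.
    move=> uv; rewrite -lee_fin EFinD !pot_fin.
    apply: le_trans (pot_le_trunc K u) _.
    apply: le_trans (leeD2r _ (trunc_lipschitz K uv)) _.
    rewrite -addeA -EFinD; apply: leeD; first exact: trunc_le_pot.
    rewrite lee_fin.
    have : 4 ^+ K * (3 * k.+1%:R^-1) * C <= e / 2.
      rewrite (_ : _ * C = 3 * 4 ^+ K * C / k.+1%:R); last by ring.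
      rewrite ler_pdivrMr//.
      have : X * e <= k.+1%:R * e by rewrite ler_pM2r// ltW.
      rewrite XeE => Xe.
      have : 0 <= M * e by rewrite mulr_ge0// ltW.
      move: Xe C0; move: (4 ^+ K) (k.+1%:R) => p r; lra.
    by move=> h; apply: le_trans (lerD h hK) _; lra.
  have yx i : `|coord3 i y - coord3 i x| <= k.+1%:R^-1 by rewrite distrC.
  have := half _ _ xy; have := half _ _ yx; rewrite ler_norml; lra.
rewrite ger0_norm ?fine_ge0 ?potential_ge0// -lee_fin pot_fin.
have r0 : 0 < k.+1%:R - M by lra.
apply: le_trans (@pot_decay y i _ r0 _) _; first by rewrite addrC subrK.
rewrite lee_fin mulrC ler_pdivrMr//.
have : X * e <= k.+1%:R * e by rewrite ler_pM2r// ltW.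
rewrite XeE -[6 * _ * C]mulrA => Xe.
have : 0 <= M * e by rewrite mulr_ge0// ltW.
have : 0 <= 4 ^+ K * C by rewrite mulr_ge0// ltW.
by move: Xe C0; move: (4 ^+ K * C) (k.+1%:R) => p r; lra.
Qed.

Lemma test_function_potential :
  [/\ forall y, potential f y \is a fin_num,
    uniform_C0 (fun y => fine (potential f y)) &
    exists B : R, forall y, fine (potential f y) <= B].
Proof.
split=> [y|//|]; first by rewrite -pot_fin.
by exists (C + 32 * M) => y; rewrite -lee_fin pot_fin.
Qed.

End test_function_potential.
End potential.

(** * Measures *)

Section measure_lemmas.
Local Open Scope ereal_scope.

Lemma variation_norm_measure (R : realType) d (T : measurableType d)
  (mu : {measure set T -> \bar R}) : variation_norm mu = mu setT.
Proof.
apply/eqP; rewrite eq_le; apply/andP; split.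
  apply: ge_ereal_sup => _ [n [F [mF tF ->]]].
  under eq_bigr do rewrite gee0_abs//.
  rewrite -(@measure_bigsetU _ _ _ mu F mF tF n).
  by apply: le_measure; rewrite ?inE//; exact: bigsetU_measurable.
apply: ereal_sup_ubound; exists 1%N.
exists (fun i => if i is 0 then setT else set0); split.
- by case.
- by apply/trivIsetP => -[|i] [|j]//= _ _ _; rewrite ?setI0 ?set0I.
- by rewrite big_ord1 gee0_abs.
Qed.

(** No measurability is assumed: nonnegative integrals are suprema over simple functions. This
    allows comparison with integrands built from g, which need not be Borel. *)
Lemma le_ge0_integral (R : realType) d (T : measurableType d)
    (mu : {measure set T -> \bar R}) (f1 f2 : T -> \bar R) :
  (forall x, 0 <= f1 x) -> (forall x, f1 x <= f2 x) ->
  \int[mu]_x f1 x <= \int[mu]_x f2 x.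
Proof.
move=> f10 f12; have f20 x : 0 <= f2 x by exact: le_trans (f12 x).
rewrite !ge0_integralE//; apply: ereal_sup_le => _ [h hf1 <-].
exists h => // x.
by apply: le_trans (hf1 x) _; rewrite !patch_setT.
Qed.

Lemma integral_mrestr (R : realType) d (T : measurableType d)
    (mu : {measure set T -> \bar R}) (D : set T) (mD : measurable D)
    (f : T -> \bar R) : measurable_fun setT f -> (forall x, 0 <= f x) ->
  \int[mrestr mu mD]_x f x = \int[mu]_(x in D) f x.
Proof.
move=> mf f0; rewrite -(setUv D) ge0_integral_setU//=; last 3 first.
- exact: measurableC.
- by rewrite setUv.
- by rewrite disj_set2E setICr.
rewrite [X in _ + X](_ : _ = 0) ?adde0.
  apply: eq_measure_integral => A mA AD.
  by rewrite /= /mrestr (setIidl AD).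
rewrite -(integral_measure_zero (~` D) f).
apply: eq_measure_integral => A mA AD.
rewrite /= /mrestr /mzero (_ : A `&` D = set0) ?measure0//.
by apply/disjoints_subset.
Qed.

Lemma scaled_pushforward (R : realType) d (T : measurableType d)
    (c N : R) (Z : measurableTypeR R -> T) :
  (0 <= c)%R -> (0 <= N)%R -> measurable_fun setT Z ->
  exists mu : {measure set T -> \bar R},
    mu setT = c%:E * N%:E /\
    forall f : T -> \bar R, measurable_fun setT f -> (forall x, 0 <= f x) ->
      \int[mu]_x f x =
      c%:E * \int[@lebesgue_measure R]_(t in `[0%R, N[) f (Z t).
Proof.
move=> c0 N0 mZ.
have mI : measurable [set` `[0%R, N[ : interval R] by exact: measurable_itv.
pose m := mrestr (@lebesgue_measure R) mI.
pose p : {measure set T -> \bar R} := pushforward m Z.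
exists (mscale (NngNum c0) (p mZ)); split.
  rewrite /= /mscale/= /pushforward preimage_setT /m /mrestr setTI.
  rewrite lebesgue_measure_itv/= lte_fin; case: ltP => [_|?].
    by rewrite oppr0 adde0.
  by congr (_ * _); congr EFin; lra.
move=> f mf f0; rewrite ge0_integral_mscale//=; congr (_ * _).
rewrite ge0_integral_pushforward// preimage_setT integral_mrestr//.
  exact: measurableT_comp.
by move=> t; exact: f0.
Qed.

End measure_lemmas.

(** * Borel minorants of Lebesgue measurable functions *)

Section completion.
Context d (T : measurableType d) (R : realType).
Variable mu : {measure set T -> \bar R}.

(** The sets squeezed in this way between a Borel set and its union with a null Borel set form a
    sigma-algebra containing the generators. *)
Lemma completed_measurable_inner (S : set T) :
  (completed_algebra_gen mu).-sigma.-measurable S ->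
  exists A Z, [/\ measurable A, measurable Z, mu Z = 0%E, A `<=` S &
    S `<=` A `|` Z].
Proof.
pose C := [set S : set T | exists A Z, [/\ measurable A, measurable Z,
  mu Z = 0%E, A `<=` S & S `<=` A `|` Z]].
suff : (completed_algebra_gen mu).-sigma.-measurable `<=` C by move=> /(_ S).
apply: smallest_sub.
  split.
  - by exists set0, set0; split => //; rewrite ?measure0//; exact: sub0set.
  (* For a complement, the inner set is what avoids both A and Z, while the null set remains Z. *)
  - move=> B [A [Z [mA mZ Z0 AB BAZ]]]; exists (~` (A `|` Z)), Z; split => //.
    + exact/measurableC/measurableU.
    + by rewrite setTD; exact: subsetC.
    + move=> x; rewrite setTD => Bx.
      have [Zx|Zx] := pselect (Z x); first by right.
      by left => -[/AB//|].
  - move=> F /choice[A /choice[Z AZ]].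
    exists (\bigcup_n A n), (\bigcup_n Z n); split.
    + by apply: bigcupT_measurable => n; have [] := AZ n.
    + by apply: bigcupT_measurable => n; have [] := AZ n.
    + apply/negligibleP.
        by apply: bigcupT_measurable => n; have [] := AZ n.
      apply: negligible_bigcup => n; have [_ mZ Z0 _ _] := AZ n.
      exact/negligibleP.
    + by apply: subset_bigcup => n _; have [] := AZ n.
    + move=> x [n _ Fx]; have [_ _ _ _ /(_ _ Fx)[]] := AZ n.
        by left; exists n.
      by right; exists n.
move=> _ [A mA [N [Z [mZ Z0 NZ]] <-]]; exists A, Z; split => //.
by apply: setUS.
Qed.

Lemma measurable_completed (A : set T) : measurable A ->
  (completed_algebra_gen mu).-sigma.-measurable A.
Proof.
move=> mA; apply: sub_sigma_algebra; exists A => //; exists set0.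
  exact: negligible_set0.
by rewrite setU0.
Qed.

End completion.

(** |g| is the supremum over rationals q >= 0 of q times the indicator of |g| > q. Each superlevel
    set is replaced by a Borel subset of it that misses only a null set; countably many null sets
    are lost. *)
Lemma lebesgue_measurable_borel_minorant (R : realType) (g : R3 R -> R) :
  lebesgue_measurable_fun g -> exists g' : R3 R -> \bar R,
  [/\ measurable_fun setT g', forall x, (0 <= g' x)%E,
    forall x, (g' x <= `|g x|%:E)%E &
    {ae leb3 R, forall x, (`|g x|%:E <= g' x)%E}].
Proof.
move=> hg.
pose S (q : rat) := g @^-1` [set r | ratr q < `|r|].
have mS q : (completed_algebra_gen (leb3 R)).-sigma.-measurable (S q).
  apply: hg; rewrite -[X in measurable X]setTI.
  have := @measurable_fun_ltr _ (measurableTypeR R) R setT (fun=> ratr q)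
    (fun r => `|r|).
  move=> /(_ _ _ measurableT [set true])/=; apply => //.
  exact: normr_measurable.
have /choice[A /choice[Z AZ]] := fun q => completed_measurable_inner (mS q).
pose a n (x : R3 R) : \bar R :=
  if @unpickle rat n is Some q then (Num.max (ratr q) 0 * \1_(A q) x)%:E
  else 0%E.
have ma n : measurable_fun setT (a n).
  rewrite /a; case: unpickle => [q|]//.
  apply/measurable_EFinP/measurable_funM => //.
  by apply: measurable_indic; have [] := AZ q.
have a_le n x : (a n x <= esups (a^~ x) 0%N)%E.
  by apply: ereal_sup_ubound; exists n.
exists (fun x => esups (a^~ x) 0%N); split.
- exact: measurable_fun_esups.
- move=> x; apply: le_trans (a_le (pickle (0 : rat)) x).
  by rewrite /a pickleK lee_fin mulr_ge0// le_max lexx orbT.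
- move=> x; apply: ge_ereal_sup => _ [n _ <-]; rewrite /a.
  case: unpickle => [q|]; last by rewrite lee_fin.
  rewrite lee_fin indicE; have [/set_mem Ax|_] := boolP (x \in A q); last first.
    by rewrite mulr0.
  rewrite mulr1 ge_max normr_ge0 andbT ltW//.
  by have [_ _ _ /(_ _ Ax)] := AZ q.
have : (leb3 R).-negligible (\bigcup_n
    if @unpickle rat n is Some q then Z q else set0).
  apply: negligible_bigcup => n; case: unpickle => [q|]; last first.
    exact: negligible_set0.
  by have [_ mZ Z0 _ _] := AZ q; exact/negligibleP.
apply: negligibleS => x /=; apply: contra_notP => nZ.
rewrite leNgt; apply/negP => lt.
have g0 : (0%E <= esups (a^~ x) 0%N)%E.
  apply: le_trans (a_le (pickle (0 : rat)) x).
  by rewrite /a pickleK lee_fin mulr_ge0// le_max lexx orbT.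
have gfin : esups (a^~ x) 0%N \is a fin_num.
  by rewrite ge0_fin_numE// (lt_trans lt)// ltry.
move: lt g0 (a_le ^~ x); rewrite -(fineK gfin) lte_fin lee_fin.
move: (fine _) => r rg r0 ar.
(* A rational strictly between g' x and |g x| puts x in S q, hence in A q off the null sets, and
   forces g' x >= q. *)
have [q] := rat_in_itvoo rg; rewrite in_itv/= => /andP[rq qg].
have [_ _ _ _ /(_ x qg)[Ax|Zx]] := AZ q; last first.
  apply: nZ; exists (pickle q); first exact: I.
  by rewrite pickleK; exact: Zx.
have := ar (pickle q); rewrite /a pickleK lee_fin indicE mem_set// mulr1.
by rewrite leNgt lt_max rq.
Qed.

(** * The dual functional *)

Section test_function_closure.
Context {R : realType}.
Implicit Types f g : R3 R -> R.

Lemma sub_cube (y : R3 R) (r s : R) : r <= s -> cube y r `<=` cube y s.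
Proof.
move=> rs x [[/=]]; rewrite !in_itv/= => /andP[? ?] /andP[? ?] /andP[? ?].
by split; [split|]; rewrite /= in_itv/=; apply/andP; split; lra.
Qed.

Lemma bounded_support_test_function f (a r : R) : measurable_fun setT f ->
  (forall x, 0 <= f x) -> 0 <= a -> 0 <= r ->
  (forall x, f x <= a * \1_(cube (0, 0, 0) r) x) -> test_function f.
Proof.
move=> mf f0 a0 r0 far; split => //; exists (a + r); first exact: addr_ge0.
move=> x; apply: le_trans (far x) _; rewrite !indicE.
have [/set_mem xr|_] := boolP (x \in cube (0, 0, 0) r); last first.
  by rewrite mulr0 mulr_ge0// addr_ge0.
rewrite (@mem_set _ (cube _ (a + r))) ?mulr1 ?lerDl//.
by apply: sub_cube xr; rewrite lerDr.
Qed.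

Lemma test_function0 : test_function (fun _ : R3 R => 0 : R).
Proof.
by apply: (@bounded_support_test_function _ 0 0) => // x; rewrite mul0r.
Qed.

Lemma test_functionD f g : test_function f -> test_function g ->
  test_function (fun x => f x + g x).
Proof.
move=> [mf f0 [M M0 fM]] [mg g0 [M' M'0 gM']].
apply: (@bounded_support_test_function _ (M + M') (M + M')) => [|x| | |x].
- exact: measurable_funD.
- exact: addr_ge0.
- exact: addr_ge0.
- exact: addr_ge0.
have le_indic (r s : R) : r <= s ->
    \1_(cube (0, 0, 0) r) x <= \1_(cube (0, 0, 0) s) x :> R.
  move=> rs; rewrite !indicE; have [/set_mem xr|_] := boolP (x \in cube _ r).
    by rewrite mem_set//; exact: sub_cube xr.
  by case: (_ \in _).
rewrite mulrDl lerD//.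
  by apply: le_trans (fM x) _; rewrite ler_wpM2l// le_indic// lerDl.
by apply: le_trans (gM' x) _; rewrite ler_wpM2l// le_indic// lerDr.
Qed.

Lemma test_functionZ (a : R) f : 0 <= a -> test_function f ->
  test_function (fun x => a * f x).
Proof.
move=> a0 [mf f0 [M M0 fM]].
apply: (@bounded_support_test_function _ (a * M) M) => [|x| | |x] //.
- exact: measurable_funM.
- exact: mulr_ge0.
- exact: mulr_ge0.
- by rewrite -mulrA ler_wpM2l.
Qed.

Lemma potential_fin_num f y : test_function f -> potential f y \is a fin_num.
Proof.
by move=> [mf f0 [M M0 fM]]; have [] := test_function_potential mf f0 M0 fM.
Qed.

Lemma uniform_C0_potential f : test_function f ->
  uniform_C0 (fun y => fine (potential f y)).
Proof.
by move=> [mf f0 [M M0 fM]]; have [] := test_function_potential mf f0 M0 fM.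
Qed.

Lemma potential_bounded f : test_function f ->
  exists2 B : R, 0 < B & forall y, fine (potential f y) <= B.
Proof.
move=> [mf f0 [M M0 fM]].
have [_ _ [B fB]] := test_function_potential mf f0 M0 fM.
exists (1 + `|B|); first by rewrite ltr_pwDl.
by move=> y; apply: le_trans (fB y) _; rewrite ler_wpDl// ler_norm.
Qed.

Lemma fine_potentialD f g y : test_function f -> test_function g ->
  fine (potential (fun x => f x + g x) y) =
  fine (potential f y) + fine (potential g y).
Proof.
move=> tf tg; have [mf f0 _] := tf; have [mg g0 _] := tg.
by rewrite potentialD// fineD//; exact: potential_fin_num.
Qed.

Lemma fine_potentialZ (a : R) f y : 0 <= a -> test_function f ->
  fine (potential (fun x => a * f x) y) = a * fine (potential f y).
Proof.
move=> a0 tf; have [mf f0 _] := tf.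
by rewrite potentialZ// fineM//; exact: potential_fin_num.
Qed.

End test_function_closure.

Section duality.
Context {R : realType} (g' : R3 R -> \bar R) (N : R).
Hypotheses (mg' : measurable_fun setT g') (g'0 : forall x, (0 <= g' x)%E)
  (N0 : 0 <= N).

Implicit Types (f h : R3 R -> R) (s B : R).

Let pairing f : \bar R := (\int[leb3 R]_x ((f x)%:E * g' x))%E.

Hypothesis pairing_le : forall f s, test_function f -> 0 < s ->
  (forall y, (potential f y <= s%:E)%E) -> (pairing f <= (N * s)%:E)%E.

Let m_pairing f : measurable_fun setT f ->
  measurable_fun setT (fun x => ((f x)%:E * g' x)%E).
Proof. by move=> mf; apply: emeasurable_funM => //; exact/measurable_EFinP. Qed.

Let pairing_ge0 f : test_function f -> (0 <= pairing f)%E.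
Proof.
by move=> [_ f0 _]; apply: integral_ge0 => x _; rewrite mule_ge0// lee_fin.
Qed.

Let L f := fine (pairing f).

Let pairing_fin f : test_function f -> pairing f \is a fin_num.
Proof.
move=> tf; rewrite ge0_fin_numE ?pairing_ge0//.
have [B B0 fB] := potential_bounded tf.
apply: le_lt_trans (pairing_le tf B0 _) (ltry _) => y.
by rewrite -(fineK (potential_fin_num y tf)) lee_fin.
Qed.

Let L_le f s : test_function f -> 0 < s ->
  (forall y, fine (potential f y) <= s) -> L f <= N * s.
Proof.
move=> tf s0 fs; rewrite -lee_fin fineK ?pairing_fin//.
apply: pairing_le => // y.
by rewrite -(fineK (potential_fin_num y tf)) lee_fin.
Qed.

Let LD f1 f2 : test_function f1 -> test_function f2 ->
  L (fun x => f1 x + f2 x) = L f1 + L f2.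
Proof.
move=> tf1 tf2; have [mf1 f10 _] := tf1; have [mf2 f20 _] := tf2.
rewrite /L -fineD ?pairing_fin//; congr fine; rewrite /pairing -ge0_integralD//.
- by apply: eq_integral => x _; rewrite EFinD ge0_muleDl ?lee_fin.
- by move=> x _; rewrite mule_ge0 ?lee_fin.
- exact: m_pairing.
- by move=> x _; rewrite mule_ge0 ?lee_fin.
- exact: m_pairing.
Qed.

Let LZ (a : R) f : 0 <= a -> test_function f -> L (fun x => a * f x) = a * L f.
Proof.
move=> a0 tf; have [mf f0 _] := tf.
have -> : a * L f = fine (a%:E * pairing f)%E by rewrite fineM// pairing_fin.
congr fine; rewrite /pairing -ge0_integralZl//.
- by apply: eq_integral => x _; rewrite EFinM muleA.
- exact: m_pairing.
- by move=> x _; rewrite mule_ge0 ?lee_fin.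
Qed.

Let L0 : L (fun=> 0) = 0.
Proof. by have := LZ (lexx 0) (@test_function0 R); rewrite !mul0r. Qed.

Notation bounded := (@bounded_on_space R (R3 R)).

Let costs (h : R3 R -> R) : set R := [set v | exists f s,
  [/\ test_function f, 0 < s, (forall y, h y + fine (potential f y) <= s) &
    v = N * s - L f]].

Let p (h : R3 R -> R^o) : R := inf (costs h).

(** From h >= - B the constraint gives Uf <= s + B, so the pairing of f is at most N (s + B). This
    is where the dual norm keeps p finite. *)
Let costs_lb h B : 0 < B -> (forall x, `|h x| <= B) ->
  lbound (costs h) (- (N * B)).
Proof.
move=> B0 hB _ [f [s [tf s0 hfs ->]]].
have : L f <= N * (s + B).
  apply: L_le => // [|y]; first exact: addr_gt0.
  by have := hfs y; have := hB y; rewrite ler_norml; lra.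
by rewrite mulrDr; lra.
Qed.

Let bounded_pos h : bounded h -> exists2 B, 0 < B & forall x, `|h x| <= B.
Proof.
move=> [B hB]; exists (1 + `|B|); first by rewrite ltr_pwDl.
by move=> x; apply: le_trans (hB x) _; rewrite ler_wpDl// ler_norm.
Qed.

Let p_le h v : bounded h -> costs h v -> p h <= v.
Proof.
move=> /bounded_pos[B B0 hB] hv; apply: ge_inf => //.
by exists (- (N * B)); exact: costs_lb.
Qed.

Let cost0 h s : 0 < s -> (forall y, h y <= s) -> costs h (N * s).
Proof.
move=> s0 hs; exists (fun=> 0), s; split => //; last by rewrite L0 subr0.
  exact: test_function0.
move=> y; rewrite [potential _ _](_ : _ = 0%E) ?addr0//.
by apply: integral0_eq => x _; rewrite mul0e.
Qed.

Let le_p h c : bounded h -> (forall v, costs h v -> c <= v) -> c <= p h.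
Proof.
move=> /bounded_pos[B B0 hB] hc; apply: lb_le_inf => //.
exists (N * B); apply: cost0 => // y.
by have := hB y; rewrite ler_norml => /andP[].
Qed.

Let boundedD h1 h2 : bounded h1 -> bounded h2 -> bounded (h1 + h2).
Proof.
move=> [B1 hB1] [B2 hB2]; exists (B1 + B2) => x.
by apply: le_trans (ler_normD _ _) _; rewrite lerD.
Qed.

Let boundedZ (a : R) h : bounded h -> bounded (a *: h).
Proof. by move=> [B hB]; exists (`|a| * B) => x; rewrite normrM ler_wpM2l. Qed.

Let costsZ (a : R) h v : 0 < a -> costs h v -> costs (fun x => a * h x) (a * v).
Proof.
move=> a0 [f [s [tf s0 hfs ->]]]; exists (fun x => a * f x), (a * s); split.
- exact: test_functionZ (ltW a0) _.
- exact: mulr_gt0.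
- by move=> y; rewrite fine_potentialZ ?(ltW a0)// -mulrDr ler_pM2l.
- by rewrite LZ ?(ltW a0)//; ring.
Qed.

Let sublinear_p : sublinear_on bounded p.
Proof.
have pZ (a : R) h : 0 < a -> bounded h -> p (a *: h) <= a * p h.
  move=> a0 bh; rewrite -ler_pdivrMl//; apply: le_p => // v hv.
  by rewrite ler_pdivrMl//; apply: p_le; [exact: boundedZ|exact: costsZ].
split=> [h1 h2 b1 b2|a h].
  rewrite -lerBlDr; apply: le_p => // _ [f1 [s1 [tf1 s10 hfs1 ->]]].
  rewrite lerBlDr -lerBlDl; apply: le_p => // _ [f2 [s2 [tf2 s20 hfs2 ->]]].
  rewrite lerBlDl; apply: p_le; first exact: boundedD.
  exists (fun x => f1 x + f2 x), (s1 + s2); split.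
  - exact: test_functionD.
  - exact: addr_gt0.
  - move=> y; rewrite fine_potentialD// addrACA.
    by apply: lerD; [exact: hfs1|exact: hfs2].
  - by rewrite LD//; ring.
rewrite le_eqVlt => /predU1P[<- bh|a0 bh]; last first.
  apply/eqP; rewrite eq_le pZ//= -ler_pdivlMl//.
  have := @pZ a^-1 (a *: h); rewrite scalerK ?gt_eqF//.
  by apply; [rewrite invr_gt0|exact: boundedZ].
rewrite scale0r mul0r; have b0 : bounded 0 by exists 0 => x; rewrite normr0.
apply/eqP; rewrite eq_le; apply/andP; split; last first.
  apply: le_p => // _ [f [s [tf s0 hfs ->]]]; rewrite subr_ge0 L_le// => y.
  by have := hfs y; rewrite add0r.
apply/ler_addgt0Pr => e e0; rewrite add0r.
have N1 : 0 < N + 1 by rewrite ltr_wpDl.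
(* Costs require s > 0 and N may be 0; this s satisfies N s <= e. *)
have s0 : 0 < e / (N + 1) by rewrite divr_gt0.
apply: le_trans (p_le b0 (cost0 s0 _)) _ => [y|]; first exact: ltW.
rewrite mulrCA ger_pMr// ler_pdivrMr// mul1r lerDl//.
Qed.

Theorem potential_duality : exists Lam : (R3 R -> R) -> R,
  [/\ forall f g, bounded f -> bounded g ->
        Lam (fun x => f x + g x) = Lam f + Lam g,
      forall (a : R) f, bounded f -> Lam (fun x => a * f x) = a * Lam f,
      forall f g, bounded f -> bounded g -> (forall x, f x <= g x) ->
        Lam f <= Lam g,
      Lam (fun=> 1) <= N &
      forall f, test_function f ->
        (\int[leb3 R]_x ((f x)%:E * g' x) <=
         (Lam (fun y => fine (potential f y)))%:E)%E].
Proof.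
have [Lam [Lamp LamD LamZ]] := hahn_banach boundedD boundedZ sublinear_p.
have bN h : bounded h -> bounded (fun x => - h x).
  by move=> [B hB]; exists B => x; rewrite normrN.
have LamN h : bounded h -> Lam (fun x => - h x) = - Lam h.
  move=> bh; have := LamZ (-1) h bh.
  rewrite mulN1r => <-; congr Lam; apply/funext => x.
  by rewrite -[RHS]/(-1 * h x) mulN1r.
have Lam_le0 h : bounded h -> (forall x, h x <= 0) -> Lam h <= 0.
  move=> bh h0; apply/ler_addgt0Pr => e e0; rewrite add0r.
  have N1 : 0 < N + 1 by rewrite ltr_wpDl.
  have s0 : 0 < e / (N + 1) by rewrite divr_gt0.
  apply: le_trans (Lamp _ bh) _; apply: le_trans (p_le bh (cost0 s0 _)) _.
    by move=> y; apply: le_trans (h0 y) (ltW s0).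
  by rewrite mulrCA ger_pMr// ler_pdivrMr// mul1r lerDl.
exists Lam; split => //.
- move=> f g bf bg fg; rewrite -subr_le0 -LamN//.
  have := LamD _ _ bf (bN _ bg) => <-; apply: Lam_le0 => [|x].
    exact: boundedD bf (bN _ bg).
  by rewrite /GRing.add/= subr_le0.
- have b1 : bounded (fun=> 1) by exists 1 => x; rewrite normr1.
  apply: le_trans (Lamp _ b1) _; rewrite -[leRHS]mulr1.
  by apply: p_le => //; apply: cost0.
move=> f tf; rewrite -[leLHS]/(pairing f) -(fineK (pairing_fin tf)) lee_fin.
have [B B0 fB] := potential_bounded tf.
have [_ f0 _] := tf.
have bf : bounded (fun y => fine (potential f y)).
  by exists B => y; rewrite ger0_norm ?fB// fine_ge0// potential_ge0.
(* At h = - Uf the pair (f, s) is admissible for every s > 0, so - Lam(Uf) <= N s - L f; then s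
   tends to 0. *)
rewrite -lerN2 -LamN//; apply/ler_addgt0Pr => e e0.
have N1 : 0 < N + 1 by rewrite ltr_wpDl.
have s0 : 0 < e / (N + 1) by rewrite divr_gt0.
apply: le_trans (Lamp _ (bN _ bf)) _.
apply: (@le_trans _ _ (N * (e / (N + 1)) - L f)).
  apply: p_le; first exact: bN.
  exists f, (e / (N + 1)); split => // y.
  by rewrite addNr ltW.
rewrite addrC lerD2l.
by rewrite mulrCA ger_pMr// ler_pdivrMr// mul1r lerDl.
Qed.

End duality.

(** * The representing measure *)

Local Open Scope ereal_scope.

Lemma kato_dual_norm_ge0 (R : realType) (g : R3 R -> R) : 0 <= kato_dual_norm g.
Proof.
apply: ereal_sup_ubound; exists (fun=> 0%R).
  split; first split.
  - move=> B mB; apply: measurable_completed; rewrite preimage_cst.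
    by case: ifP.
  - apply: le_lt_trans (ltry 0%R); apply: ge_ereal_sup => _ [y _ <-].
    by rewrite integral0_eq// => x _; rewrite normr0 mul0e.
  - apply: (@le_trans _ _ 0) => //; apply: ge_ereal_sup => _ [y _ <-].
    by rewrite integral0_eq// => x _; rewrite normr0 mul0e.
by apply: integral0_eq => x _; rewrite mul0r normr0.
Qed.

(** The bound on the potential says that f / s lies in the unit ball of the Kato class, so the dual
    norm applies to it; g' <= |g| everywhere transfers the bound to g'. *)
Lemma pairing_le_kato_dual_norm (R : realType) (g f : R3 R -> R)
    (g' : R3 R -> \bar R) (N s : R) :
  kato_dual_norm g = N%:E -> measurable_fun setT g' -> (forall x, 0 <= g' x) ->
  (forall x, g' x <= `|g x|%:E) -> test_function f -> (0 < s)%R ->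
  (forall y, potential f y <= s%:E) ->
  \int[leb3 R]_x ((f x)%:E * g' x) <= (N * s)%:E.
Proof.
move=> gN mg' g'0 g'g [mf f0 _] s0 fs.
have sV : (0 <= s^-1)%R by rewrite invr_ge0 ltW.
pose u x := (s^-1 * f x)%R.
have u0 x : (0 <= u x)%R by rewrite mulr_ge0.
have norm_u : kato_norm u <= 1.
  apply: ge_ereal_sup => _ [y _ <-].
  under eq_integral do rewrite (ger0_norm (u0 _)).
  rewrite -[leLHS]/(potential u y) potentialZ//.
  by rewrite lee_pdivrMl// mule1.
have kato_u : kato u.
  split; last exact: le_lt_trans norm_u (ltry _).
  move=> B mB; apply: measurable_completed; rewrite -[X in measurable X]setTI.
  by apply: measurable_funM.
have ug : \int[leb3 R]_x `|u x * g x|%:E <= N%:E.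
  by rewrite -gN; apply: ereal_sup_ubound; exists u.
rewrite mulrC EFinM -lee_pdivrMl//; apply: le_trans ug.
have mfg : measurable_fun setT (fun x => (f x)%:E * g' x).
  by apply: emeasurable_funM => //; exact/measurable_EFinP.
rewrite -(ge0_integralZl _ measurableT mfg) ?lee_fin//; last first.
  by move=> x _; rewrite mule_ge0 ?lee_fin.
apply: le_ge0_integral => x; first by rewrite !mule_ge0 ?lee_fin.
rewrite normrM (ger0_norm (u0 x)) muleA -EFinM [leRHS]EFinM.
by apply: lee_wpmul2l; rewrite ?lee_fin//; exact: u0.
Qed.

Section representation.
Context {R : realType} (Z : measurableTypeR R -> R3 R) (N : R).
Hypothesis mZ : measurable_fun setT Z.

Let mI : measurable [set` `[0%R, N[ : interval R].
Proof. exact: measurable_itv. Qed.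

Let Upot x := \int[@lebesgue_measure R]_(t in `[0%R, N[) riesz_kernel x (Z t).

Let indic_int (phi : measurableTypeR R -> \bar R) :
  \int[@lebesgue_measure R]_(t in `[0%R, N[) phi t =
  \int[@lebesgue_measure R]_t ((\1_[set` `[0%R, N[ : interval R] t)%:E * phi t).
Proof.
rewrite integral_mkcond; apply: eq_integral => t _.
by rewrite patchE indicE; case: (_ \in _); rewrite ?mul1e ?mul0e.
Qed.

Lemma tonelli_riesz_kernel (f : R3 R -> R) : measurable_fun setT f ->
  (forall x, (0 <= f x)%R) ->
  \int[@lebesgue_measure R]_(t in `[0%R, N[) potential f (Z t) =
  \int[leb3 R]_x ((f x)%:E * Upot x).
Proof.
move=> mf f0.
pose F (z : measurableTypeR R * R3 R) : \bar R :=
  (\1_[set` `[0%R, N[ : interval R] z.1)%:E *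
  ((f z.2)%:E * riesz_kernel z.2 (Z z.1)).
have mk : measurable_fun [set: measurableTypeR R * R3 R]
    (fun z => riesz_kernel z.2 (Z z.1)).
  have mh : measurable_fun [set: measurableTypeR R * R3 R]
      (fun z => (z.2, Z z.1)).
    apply: measurable_fun_pair; first exact: measurable_snd.
    exact: (measurableT_comp mZ measurable_fst).
  exact: (measurableT_comp (@measurable_riesz_kernel R) mh).
have mF : measurable_fun setT F.
  apply: emeasurable_funM.
    apply/measurable_EFinP; exact: (measurableT_comp
      (@measurable_indic _ (measurableTypeR R) R setT _ mI) measurable_fst).
  apply: emeasurable_funM => //.
  by apply/measurable_EFinP; exact: (measurableT_comp mf measurable_snd).
have F0 z : 0 <= F z.
  by rewrite !mule_ge0 ?lee_fin ?riesz_kernel_ge0.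
rewrite indic_int.
transitivity (\int[@lebesgue_measure R]_t \int[leb3 R]_x F (t, x)).
  apply: eq_integral => t _; rewrite /F/= ge0_integralZl//.
  - exact: measurable_potential_integrand.
  - by move=> x _; rewrite mule_ge0 ?lee_fin ?riesz_kernel_ge0.
rewrite (tonelli3 mF F0); apply: eq_integral => x _.
rewrite /F/= -(indic_int (fun t => (f x)%:E * riesz_kernel x (Z t))).
rewrite ge0_integralZl//.
- apply: measurable_funTS; exact: (measurable_fun_pair1 x mk).
- by move=> t _; exact: riesz_kernel_ge0.
- by rewrite lee_fin.
Qed.

Lemma measurable_integral_riesz_kernel : measurable_fun setT Upot.
Proof.
pose F (z : R3 R * measurableTypeR R) : \bar R :=
  (\1_[set` `[0%R, N[ : interval R] z.2)%:E * riesz_kernel z.1 (Z z.2).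
have mF : measurable_fun setT F.
  apply: emeasurable_funM; last first.
    have mh : measurable_fun [set: R3 R * measurableTypeR R]
        (fun z => (z.1, Z z.2)).
      apply: measurable_fun_pair; first exact: measurable_fst.
      exact: (measurableT_comp mZ measurable_snd).
    exact: (measurableT_comp (@measurable_riesz_kernel R) mh).
  apply/measurable_EFinP; exact: (measurableT_comp
    (@measurable_indic _ (measurableTypeR R) R setT _ mI) measurable_snd).
have F0 z : 0 <= F z by rewrite mule_ge0 ?lee_fin ?riesz_kernel_ge0.
have :=
  @measurable_fun_fubini_tonelli_F _ _ _ _ R (@lebesgue_measure R) F mF F0.
by apply: eq_measurable_fun => x _; rewrite /Upot indic_int.
Qed.

Lemma measurable_potential (f : R3 R -> R) : measurable_fun setT f ->
  (forall x, (0 <= f x)%R) -> measurable_fun setT (potential f).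
Proof.
move=> mf f0.
pose F (z : R3 R * R3 R) : \bar R := (f z.2)%:E * riesz_kernel z.2 z.1.
have mswap : measurable_fun [set: R3 R * R3 R] (fun z => (z.2, z.1)).
  exact: (measurable_fun_pair measurable_snd measurable_fst).
have mF : measurable_fun setT F.
  apply: emeasurable_funM.
    by apply/measurable_EFinP; exact: (measurableT_comp mf measurable_snd).
  exact: (measurableT_comp (@measurable_riesz_kernel R) mswap).
have F0 z : 0 <= F z by rewrite mule_ge0 ?lee_fin ?riesz_kernel_ge0.
exact: (@measurable_fun_fubini_tonelli_F _ _ _ _ R (@leb3s R) F mF F0).
Qed.

(** The indicator of E n, the bounded set where g' exceeds [Upot] by at least 1 / (n + 1), is a test
    function. Testing with it bounds the measure of E n divided by n + 1 by 0. *)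
Lemma ae_le_integral_riesz_kernel (g' : R3 R -> \bar R) :
  measurable_fun setT g' -> (forall x, 0 <= g' x) ->
  (forall x, g' x \is a fin_num) ->
  (forall f, test_function f -> \int[leb3 R]_x ((f x)%:E * g' x) < +oo) ->
  (forall f, test_function f -> \int[leb3 R]_x ((f x)%:E * g' x) <=
    \int[@lebesgue_measure R]_(t in `[0%R, N[) potential f (Z t)) ->
  {ae leb3 R, forall x, g' x <= Upot x}.
Proof.
move=> mg' g'0 g'fin g'lty g'le.
have mUpot := measurable_integral_riesz_kernel.
have Upot0 x : 0 <= Upot x.
  by apply: integral_ge0 => t _; exact: riesz_kernel_ge0.
pose E n := [set x | Upot x + n.+1%:R^-1%:E <= g' x] `&` cube (0, 0, 0)%R n%:R.
have mE n : measurable (E n).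
  apply: measurableI; last exact: measurable_cube.
  rewrite -[X in measurable X]setTI; apply: measurable_lee => //.
  exact: emeasurable_funD.
have E0 n : leb3 R (E n) = 0.
  pose f : R3 R -> R := \1_(E n).
  have mf : measurable_fun setT f by exact: measurable_indic.
  have f0 x : (0 <= f x)%R by [].
  have tf : test_function f.
    apply: (@bounded_support_test_function _ _ 1 n%:R) => // x.
    rewrite mul1r /f !indicE; have [/set_mem[_ xc]|_] := boolP (x \in E n).
      by rewrite mem_set.
    by case: (_ \in _).
  have le1 : \int[leb3 R]_x ((f x)%:E * g' x) <=
      \int[leb3 R]_x ((f x)%:E * Upot x).
    by rewrite -tonelli_riesz_kernel//; exact: g'le.
  have m1 : measurable_fun setT (fun x => (f x)%:E * Upot x).
    by apply: emeasurable_funM => //; exact/measurable_EFinP.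
  have m2 : measurable_fun setT (fun x => (f x)%:E * n.+1%:R^-1%:E).
    by apply: emeasurable_funM => //; exact/measurable_EFinP.
  have m3 : measurable_fun setT (fun x => (f x)%:E * g' x).
    by apply: emeasurable_funM => //; exact/measurable_EFinP.
  have p1 x : 0 <= (f x)%:E * Upot x by rewrite mule_ge0 ?lee_fin.
  have p2 x : 0 <= (f x)%:E * n.+1%:R^-1%:E by rewrite mule_ge0 ?lee_fin.
  have le2 : \int[leb3 R]_x ((f x)%:E * Upot x) +
      \int[leb3 R]_x ((f x)%:E * n.+1%:R^-1%:E) <=
      \int[leb3 R]_x ((f x)%:E * g' x).
    rewrite -ge0_integralD//; apply: le_ge0_integral => x.
      exact: adde_ge0.
    rewrite -ge0_muleDr ?lee_fin// /f indicE.
    have [/set_mem[xE _]|_] := boolP (x \in E n); last by rewrite !mul0e.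
    by rewrite !mul1e.
  (* Finiteness allows this integral to be cancelled from both sides. *)
  have fin1 : \int[leb3 R]_x ((f x)%:E * Upot x) \is a fin_num.
    rewrite ge0_fin_numE ?integral_ge0//.
    apply: le_lt_trans (g'lty _ tf); apply: le_trans le2.
    by rewrite leeDl// integral_ge0.
  have := le_trans le2 le1; rewrite -[leRHS]adde0 leeD2lE//.
  under eq_integral do rewrite muleC.
  rewrite ge0_integralZl//; last 2 first.
  - exact/measurable_EFinP.
  - by move=> x _; rewrite lee_fin.
  rewrite integral_indic// setIT => le0.
  apply/eqP; rewrite eq_le measure_ge0 andbT.
  have := lee_wpmul2l (_ : 0 <= n.+1%:R%:E) le0; rewrite mule0 muleA -EFinM.
  by rewrite divff// mul1e; apply; rewrite lee_fin.
have : (leb3 R).-negligible (\bigcup_n E n).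
  apply: negligible_bigcup => n.
  by apply/negligibleP; [exact: mE|exact: E0].
apply: negligibleS => x /= /negP; rewrite -ltNge => zg.
have zfin : Upot x \is a fin_num.
  by rewrite ge0_fin_numE// (lt_trans zg)// ltey_eq g'fin.
move: zg; rewrite -(fineK zfin) -(fineK (g'fin x)) lte_fin => zg.
pose a := (fine (g' x) - fine (Upot x))%R.
have a0 : (0 < a)%R by rewrite subr_gt0.
pose n := Num.truncn (a^-1 + `|x.1.1| + `|x.1.2| + `|x.2|)%R.
have nP : (a^-1 + `|x.1.1| + `|x.1.2| + `|x.2| < n.+1%:R)%R.
  exact: truncnS_gt.
have aV : (0 < a^-1)%R by rewrite invr_gt0.
have := normr_ge0 x.1.1; have := normr_ge0 x.1.2; have := normr_ge0 x.2.
move=> h2 h1 h0.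
exists n.+1 => //; split.
  rewrite /= -(fineK zfin) -(fineK (g'fin x)) -EFinD lee_fin.
  suff : (n.+2%:R^-1 <= a)%R by rewrite /a lerBrDl.
  rewrite -[leRHS]invrK lef_pV2 ?posrE// (@le_trans _ _ n.+1%:R)%R//.
    lra.
  by rewrite ler_nat.
by split; [split|]; rewrite /= in_itv/= sub0r add0r -ler_norml; lra.
Qed.

End representation.

Theorem proposition1p7 (R : realType) (g : R3 R -> R)
    (hg : lebesgue_measurable_fun g) :
  @kato_dual R g <->
  exists mu : {measure set (R3 R) -> \bar R},
    [/\ variation_norm mu = mu [set: R3 R],
        mu [set: R3 R] = (4 * pi)%R%:E * kato_dual_norm g,
        (4 * pi)%R%:E * kato_dual_norm g < +oo &
        {ae leb3 R, forall x, `|g x|%:E <= inv_laplacian mu x}].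
Proof.
have pi4 : (0 < 4 * pi :> R)%R by rewrite mulr_gt0// pi_gt0.
have norm0 := kato_dual_norm_ge0 g.
split=> [[_ normlty]|[mu [_ _ fin _]]]; last first.
  (* Finiteness of the norm is recovered from that of its product with 4 * pi > 0. *)
  split => //; move: fin norm0; case: (kato_dual_norm g) => //.
    by move=> *; exact: ltry.
  by rewrite gt0_muley// lte_fin.
have normfin : kato_dual_norm g \is a fin_num by rewrite ge0_fin_numE.
pose N := fine (kato_dual_norm g).
have gN : kato_dual_norm g = N%:E by rewrite fineK.
have N0 : (0 <= N)%R by rewrite fine_ge0.
have [g' [mg' g'0 g'g gg']] := lebesgue_measurable_borel_minorant hg.
have g'fin x : g' x \is a fin_num.
  by rewrite ge0_fin_numE// (le_lt_trans (g'g x))// ltry.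
have pairing_le f s : test_function f -> (0 < s)%R ->
    (forall y, potential f y <= s%:E) ->
    \int[leb3 R]_x ((f x)%:E * g' x) <= (N * s)%:E.
  exact: pairing_le_kato_dual_norm gN mg' g'0 g'g.
have [Lam [LamD LamZ Lam_le Lam1 Lam_pot]] :=
  potential_duality mg' g'0 N0 pairing_le.
have [Z [mZ LamZle]] := riesz_C0 LamD LamZ Lam_le Lam1.
have [mu [muT muE]] := scaled_pushforward (ltW pi4) N0 mZ.
exists mu; split.
- exact: variation_norm_measure.
- by rewrite muT gN.
- by rewrite gN -EFinM ltry.
have gU : {ae leb3 R, forall x,
    g' x <= \int[@lebesgue_measure R]_(t in `[0%R, N[) riesz_kernel x (Z t)}.
  apply: ae_le_integral_riesz_kernel => // f tf.
    have [B B0 fB] := potential_bounded tf.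
    apply: le_lt_trans (pairing_le _ _ tf B0 _) (ltry _) => y.
    by rewrite -(fineK (potential_fin_num y tf)) lee_fin.
  have [mf f0 _] := tf; have [B B0 fB] := potential_bounded tf.
  have pot0 y : (0 <= fine (potential f y))%R.
    by rewrite fine_ge0// potential_ge0.
  apply: le_trans (Lam_pot _ tf) _; apply: le_trans (LamZle _ _ _ _ _) _ => //.
  - apply: (measurableT_comp (fine_measurable measurableT)).
    exact: measurable_potential.
  - by exists B => y; rewrite ger0_norm.
  - exact: uniform_C0_potential.
  rewrite le_eqVlt; apply/orP; left; apply/eqP/eq_integral => t _.
  by rewrite fineK// potential_fin_num.
have {}gU : {ae leb3 R, forall x, g' x <= inv_laplacian mu x}.
  apply: filterS gU => x /le_trans; apply; rewrite /inv_laplacian muE.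
  (* The factor 4 * pi in the mass of mu cancels the constant of the inverse Laplacian. *)
  - by rewrite muleA -EFinM mulVf ?gt_eqF// mul1e.
  - exact: (measurable_fun_pair2 x (@measurable_riesz_kernel R)).
  - by move=> y; exact: riesz_kernel_ge0.
by apply: filterS2 gg' gU => x; exact: le_trans.
Qed.
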